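(* Let $X$ and $Y$ be shaped pseudo 3-manifolds and suppose that $Y=X_e$ is obtained from $X$ by a leveled shaped $3-2$ Pachner move along an edge $e$. Then the induced map $$\tilde P_r\colon \tilde\Omega_{X,r}(e)^{-1}(2\pi)\to\tilde S_r(Y)$$ is a Poisson isomorphism, and it is covered by an affine $\mathbb R$-bundle isomorphism from $\widetilde{LS}_r(X)|_{\tilde\Omega_{X,r}(e)^{-1}(2\pi)}$ to $\widetilde{LS}_r(Y)$.
   Context: Oriented triangulated pseudo 3-manifold: take a disjoint union of finitely many standard 3-simplices in $\mathbb R^3$, each with totally ordered vertices, and identify some of the codimension-1 faces in pairs by vertex-order-preserving, orientation-reversing affine homeomorphisms; the quotient CW-complex is $X$. $\Delta_i(X)$ is the set of $i$-cells; $\Delta_3^1(X)$ is the set of pairs (tetrahedron, edge of that tetrahedron), and $\phi^{3,1}\colon\Delta_3^1(X)\to\Delta_1(X)$ sends such a pair to the corresponding edge of $X$. A shape structure on $X$ is a map $\alpha_X\colon\Delta_3^1(X)\to\mathbb R_{>0}$ such that the three values at the edges from each vertex of each tetrahedron sum to $\pi$; a generalized shape structure is the same with values in $\mathbb R$. Opposite edges of a tetrahedron carry equal values. A shaped pseudo 3-manifold is one with a shape structure. $\tilde S(X)$ is the set of generalized shape structures; the weight function is $\omega_X(e)=\sum_{a\in(\phi^{3,1})^{-1}(e)}\alpha_X(a)$, $e\in\Delta_1(X)$, and $\tilde\Omega_X\colon\tilde S(X)\to\mathbb R^{\Delta_1(X)}$ sends $\alpha_X$ to $\omega_X$. An edge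 is balanced if it is internal and has weight $2\pi$. A leveled (generalized) shape structure is a pair $(\alpha_X,\ell_X)$ with $\ell_X\in\mathbb R$. $p\colon\Delta_3^1(X)\to\Delta_3^{1/p}(X)$ is the quotient identifying opposite edges of each tetrahedron. The orientation induces a cyclic order on the three pairs of opposite edges of each tetrahedron (from the cyclic order of the three edges at a vertex). $\varepsilon_{a,b}=-\varepsilon_{b,a}\in\{0,\pm1\}$ ($a,b\in\Delta_3^{1/p}(X)$) is $0$ if the underlying tetrahedra are distinct and $+1$ if they coincide and $b$ is cyclically preceded by $a$. Based gauge equivalence: $(\alpha_X,\ell_X)\sim(\alpha'_X,\ell'_X)$ if there is $g\colon\Delta_1(X)\to\mathbb R$ vanishing on $\Delta_1(\partial X)$ with $\alpha'_X(a)=\alpha_X(a)+\pi\sum_{b\in\Delta_3^1(X)}\varepsilon_{p(a),p(b)}g(\phi^{3,1}(b))$ for all $a\in\Delta_3^1(X)$ and $\ell'_X=\ell_X+\sum_{e}g(e)\sum_{a\in(\phi^{3,1})^{-1}(e)}(\frac13-\frac{\alpha_X(a)}\pi)$; forgetting levels gives the equivalence for generalized shape structures. $\tilde S_r(X)$ and $\widetilde{LS}_r(X)$ are the sets of based gauge equivalence classes of generalized shape structures and of leveled generalized shape structures; the latter is an affine $\mathbb R$-bundle over the former. $\tilde\Omega_X$ is gauge invariant and descends to $\tilde\Omega_{X,r}$. $\tilde\Omega_{X,r}(e)^{-1}(2\pi)$ is the set of classes whose weight at $e$ equals $2\pi$. The Poisson structure on $\tilde S_r(X)$ is the one induced by reduction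 from the Neumann–Zagier symplectic structure on $\tilde S(X)$, whose Poisson bracket is $\{\alpha_a,\alpha_b\}=\varepsilon_{a,b}$, $a,b\in\Delta_3^{1/p}(X)$, where $\alpha_a$ denotes the value at the pair of opposite edges $a$; its symplectic leaves are the fibers of $\tilde\Omega_{X,r}$. Shaped $3-2$ Pachner move: let $e$ be a balanced edge of $X$ shared by exactly three distinct tetrahedra $t_1,t_2,t_3$, and let $S$ be the sub-pseudo-manifold they form. Its underlying space has another triangulation $S_e$ with two tetrahedra $t_4,t_5$, the same boundary triangulation, and $\Delta_1(S_e)=\Delta_1(S)\setminus\{e\}$. $Y=X_e$ is obtained by replacing $S$ by $S_e$, with the unique shape structure on $S_e$ inducing the same weights as $S$. Explicitly, for suitable labelings $(\alpha_i,\beta_i,\gamma_i)$ of the angles of $t_i$, where $\alpha_1,\alpha_2,\alpha_3$ are the angles at $e$: $\alpha_4=\beta_2+\gamma_1$, $\beta_4=\beta_1+\gamma_3$, $\gamma_4=\beta_3+\gamma_2$, $\alpha_5=\beta_1+\gamma_2$, $\beta_5=\beta_3+\gamma_1$, $\gamma_5=\beta_2+\gamma_3$. The same formulas define a map $\tilde P\colon\tilde\Omega_X(e)^{-1}(2\pi)\to\tilde S(Y)$ on generalized shape structures with weight $2\pi$ at $e$ (unchanged on tetrahedra outside $S$), and $\tilde P_r$ is the map it induces on based gauge equivalence classes. The move is a leveled shaped $3-2$ Pachner move from $(X,\ell_X)$ to $(Y,\ell_Y)$ if moreover $$\ell_Y=\ell_X+\frac1{12\pi}\sum_{a\in(\phi^{3,1})^{-1}(e)}\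 \sum_{b\in\Delta_3^1(X)}\varepsilon_{p(a),p(b)}\,\alpha_X(b).$$ *)

(* Defs.v *)
From HB Require Import structures.
From mathcomp Require Import all_boot all_order all_algebra.
From mathcomp Require Import boolp classical_sets functions reals topology.
From mathcomp Require Import normedtype derive trigo.

Set Implicit Arguments.
Unset Strict Implicit.
Unset Printing Implicit Defensive.

Import Order.TTheory GRing.Theory Num.Theory numFieldNormedType.Exports.
Local Open Scope ring_scope.

(* Every tetrahedron has vertex set 'I_4 with its natural order; [sgn t] tells
   whether that order is positive for the orientation of [t].  The face (t, i)
   is the one opposite to the vertex i.  Since gluings preserve the vertex
   order, a gluing is determined by the pair of faces it identifies.  Relative
   to the order of its vertices, the face (t, i) carries the boundary
   orientation (-1) ^ i times the sign of t, so [glue_rev] says that gluings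
   reverse orientation; in particular no face is glued to itself. *)
Record pseudo3 := Pseudo3 {
  tet : finType;
  sgn : tet -> bool;
  glue : tet * 'I_4 -> option (tet * 'I_4);
  glue_sym : forall f f', glue f = Some f' -> glue f' = Some f;
  glue_rev : forall f f', glue f = Some f' ->
    sgn f.1 (+) odd f.2 != sgn f'.1 (+) odd f'.2 }.

Definition tedge := {x : 'I_4 * 'I_4 | (x.1 < x.2)%N}.

Definition ends (x : tedge) : pred 'I_4 :=
  fun v => (v == (val x).1) || (v == (val x).2).

(* $\Delta_3^1(X)$ *)
Definition tetedge (X : pseudo3) : finType := (tet X * tedge)%type.

(* [a] and [b] are the same edge [x] of a triangle along which two faces are
   glued; [lift i] is the increasing map from the vertices 'I_3 of the face
   opposite to [i] into 'I_4. *)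
Definition eglue (X : pseudo3) (a b : tetedge X) : bool :=
  [exists i : 'I_4, exists i' : 'I_4, exists x : 'I_3 * 'I_3,
    [&& glue (a.1, i) == Some (b.1, i'),
        val a.2 == (lift i x.1, lift i x.2)
      & val b.2 == (lift i' x.1, lift i' x.2)]].

Definition eclass (X : pseudo3) (a : tetedge X) : {set tetedge X} :=
  finset (connect (@eglue X) a).

(* $\Delta_1(X)$ *)
Definition edge (X : pseudo3) : finType :=
  {A : {set tetedge X} | [exists a, A == eclass a]}.

Lemma eclassP (X : pseudo3) (a : tetedge X) : [exists b, eclass a == eclass b].
Proof. by apply/existsP; exists a. Qed.

(* $\phi^{3,1}$ *)
Definition phi (X : pseudo3) (a : tetedge X) : edge X :=
  exist _ (eclass a) (eclassP a).

(* $\Delta_1(\partial X)$: the edges lying on some unpaired face. *)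
Definition bd_edge (X : pseudo3) (e : edge X) : bool :=
  [exists a : tetedge X, (phi a == e) &&
    [exists i : 'I_4, (glue (a.1, i) == None) && ~~ ends a.2 i]].

(* $\Delta_3^{1/p}(X)$: the index k : 'I_3 stands for the pair of opposite edges
   made of {0, k+1} and of the complementary edge. *)
Definition oppedges (X : pseudo3) : finType := (tet X * 'I_3)%type.

Definition opp_pair (X : pseudo3) (a : tetedge X) : oppedges X :=
  let: (i, j) := val a.2 in
  (a.1, inord (if i == ord0 then j.-1 else (5 - i - j)%N)).

(* In a positive tetrahedron the cyclic order of the pairs of opposite edges is
   that of the edges 01, 02, 03 at the vertex 0. *)
Definition eps (R : realType) (X : pseudo3) (a b : oppedges X) : R :=
  if a.1 == b.1 then
    (-1) ^+ (~~ sgn a.1) * ((b.2 == ordS a.2)%:R - (a.2 == ordS b.2)%:R)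
  else 0.

Record gshape (R : realType) (X : pseudo3) := GShape {
  angle :> tetedge X -> R;
  angle_sum : forall (t : tet X) (v : 'I_4),
    \sum_(a : tetedge X | (a.1 == t) && ends a.2 v) angle a = pi }.

Definition is_shape (R : realType) (X : pseudo3) (al : gshape R X) : Prop :=
  forall a, 0 < al a.

Definition weight (R : realType) (X : pseudo3) (al : gshape R X) (e : edge X) : R :=
  \sum_(a : tetedge X | phi a == e) al a.

Definition balanced (R : realType) (X : pseudo3) (al : gshape R X) (e : edge X) :
  Prop := ~~ bd_edge e /\ weight al e = 2 * pi.

Definition lgshape (R : realType) (X : pseudo3) := (gshape R X * R)%type.

Definition gauge_angle (R : realType) (X : pseudo3) (g : edge X -> R)
    (al al' : gshape R X) : Prop :=
  forall a, al' a =
    al a + pi * \sum_(b : tetedge X) eps R (opp_pair a) (opp_pair b) * g (phi b).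

Definition gauge_level (R : realType) (X : pseudo3) (g : edge X -> R)
    (al : gshape R X) : R :=
  \sum_(e : edge X) g e *
    \sum_(a : tetedge X | phi a == e) (3%:R^-1 - al a / pi).

Definition gauge_equiv (R : realType) (X : pseudo3) (al al' : gshape R X) : Prop :=
  exists2 g : edge X -> R, forall e, bd_edge e -> g e = 0 & gauge_angle g al al'.

Definition lgauge_equiv (R : realType) (X : pseudo3) (x x' : lgshape R X) : Prop :=
  exists2 g : edge X -> R, forall e, bd_edge e -> g e = 0 &
    gauge_angle g x.1 x'.1 /\ x'.2 = x.2 + gauge_level g x.1.

Definition quot (T : Type) (r : T -> T -> Prop) : Type :=
  {C : set T | exists x, C = r x}.

Definition cls (T : Type) (r : T -> T -> Prop) (x : T) : quot r :=
  exist _ (r x) (ex_intro _ x erefl).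

Definition rep (T : Type) (r : T -> T -> Prop) (c : quot r) : T :=
  sval (cid (proj2_sig c)).

(* $\tilde S_r(X)$ and $\widetilde{LS}_r(X)$ *)
Definition Sr (R : realType) (X : pseudo3) := quot (@gauge_equiv R X).
Definition LSr (R : realType) (X : pseudo3) := quot (@lgauge_equiv R X).

Definition weight_r (R : realType) (X : pseudo3) (c : Sr R X) : edge X -> R :=
  weight (rep c).

(* $\tilde\Omega_{X,r}(e)^{-1}(w)$ *)
Definition level_set (R : realType) (X : pseudo3) (e : edge X) (w : R) :
    set (Sr R X) :=
  fun c => weight_r c e = w.

Definition LSproj (R : realType) (X : pseudo3) (c : LSr R X) : Sr R X :=
  cls _ (rep c).1.

Definition LStrans (R : realType) (X : pseudo3) (s : R) (c : LSr R X) : LSr R X :=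
  cls _ ((rep c).1, (rep c).2 + s).

Definition iter_derive (R : realType) (V : normedModType R) (vs : seq V) (F : V -> R) :
    V -> R :=
  foldr (fun v G x => 'D_v G x) F vs.

(* $C^\infty$: all iterated directional derivatives are differentiable. *)
Definition smooth (R : realType) (V : normedModType R) (F : V -> R) : Prop :=
  forall (vs : seq V) (x : V), differentiable (iter_derive vs F) x.

(* To be used when [i] embeds [T] as a closed affine subspace of [V], [r] is the
   orbit relation of a free and proper affine action of a vector group on [T],
   up to a trivially acting subgroup, and [Z] is a subset of the quotient whose
   preimage in [T] is again a closed affine subspace.  A function on [Z] is
   then smooth iff its pull-back to that preimage extends to a smooth function
   on [V]. *)
Definition is_lift (R : realType) (V : normedModType R) (T : Type)
    (r : T -> T -> Prop) (i : T -> V) (Z : set (quot r)) (f : quot r -> R)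
    (F : V -> R) : Prop :=
  smooth F /\ forall x, Z (cls r x) -> f (cls r x) = F (i x).

Definition smooth_on (R : realType) (V : normedModType R) (T : Type)
    (r : T -> T -> Prop) (i : T -> V) (Z : set (quot r)) (f : quot r -> R) : Prop :=
  exists F, is_lift i Z f F.

Definition diffeo (R : realType) (V V' : normedModType R) (T T' : Type)
    (r : T -> T -> Prop) (r' : T' -> T' -> Prop) (i : T -> V) (i' : T' -> V')
    (Z : set (quot r)) (Z' : set (quot r')) (h : quot r -> quot r') : Prop :=
  set_bij Z Z' h /\ forall f, smooth_on i' Z' f <-> smooth_on i Z (f \o h).

Definition coord (R : realType) (X : pseudo3) (al : gshape R X) :
    'rV[R]_#|tetedge X| :=
  \row_i al (enum_val i).

Definition lcoord (R : realType) (X : pseudo3) (x : lgshape R X) :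
    ('rV[R]_#|tetedge X| * R)%type :=
  (coord x.1, x.2).

Definition pderiv (R : realType) (X : pseudo3) (a : tetedge X)
    (F : 'rV[R]_#|tetedge X| -> R) : 'rV[R]_#|tetedge X| -> R :=
  fun x => 'D_(delta_mx 0 (enum_rank a)) F x.

(* The bracket with $\{\alpha_a,\alpha_b\}=\varepsilon_{a,b}$, extended to
   functions of the coordinates $\alpha_a$ by the Leibniz rule. *)
Definition NZbracket (R : realType) (X : pseudo3)
    (F G : 'rV[R]_#|tetedge X| -> R) (x : 'rV[R]_#|tetedge X|) : R :=
  \sum_(a : tetedge X) \sum_(b : tetedge X)
    eps R (opp_pair a) (opp_pair b) * pderiv a F x * pderiv b G x.

Definition lift_of (R : realType) (X : pseudo3) (Z : set (Sr R X))
    (f : Sr R X -> R) : 'rV[R]_#|tetedge X| -> R :=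
  xget (fun=> 0) (is_lift (@coord R X) Z f).

(* The reduced Poisson bracket of smooth functions on [Z], where [Z] is all of
   $\tilde S_r(X)$ or a level set of weights (a union of symplectic leaves):
   pull back, extend, and take the bracket above.  The vectors
   $\sum_b\varepsilon_{a,b}\partial_b$ are tangent to $\tilde S(X)$, and the
   Hamiltonian vector field of the weight of an internal edge is a gauge
   direction, so the value depends neither on the extension nor on the
   representative. *)
Definition poisson (R : realType) (X : pseudo3) (Z : set (Sr R X))
    (f g : Sr R X -> R) (c : Sr R X) : R :=
  NZbracket (lift_of Z f) (lift_of Z g) (coord (rep c)).

Definition poisson_iso (R : realType) (X Y : pseudo3) (Z : set (Sr R X))
    (W : set (Sr R Y)) (h : Sr R X -> Sr R Y) : Prop :=
  diffeo (@coord R X) (@coord R Y) Z W h /\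
  forall f g, smooth_on (@coord R Y) W f -> smooth_on (@coord R Y) W g ->
    forall c, Z c -> poisson Z (f \o h) (g \o h) c = poisson W f g (h c).

(* The fibres of [LSproj] are R-torsors under [LStrans]. *)
Definition affine_bundle_iso (R : realType) (X Y : pseudo3) (Z : set (Sr R X))
    (W : set (Sr R Y)) (h : Sr R X -> Sr R Y) (L : LSr R X -> LSr R Y) : Prop :=
  [/\ diffeo (@lcoord R X) (@lcoord R Y)
        (fun c => Z (LSproj c)) (fun c => W (LSproj c)) L,
      forall c, Z (LSproj c) -> LSproj (L c) = h (LSproj c)
    & forall s c, Z (LSproj c) -> L (LStrans s c) = LStrans s (L c)].

(* The bipyramid has vertices 'I_5, ordered so that all gluings are increasing:
   the poles p < q, which are the ends of e, and the three others (equatorial).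
   For each k the 4-set 'I_5 minus k is a tetrahedron whose vertices are
   numbered by [lift k : 'I_4 -> 'I_5].  S consists of those omitting an
   equatorial vertex ([old k]) and S_e of those omitting a pole ([new k]);
   together they form the boundary of a 4-simplex, of which S and S_e carry
   opposite orientations.  [old], [new] and [keep] are only meaningful on
   equatorial vertices, on poles, and on tetrahedra outside S, respectively.
   Outer faces of S may be glued to each other in X. *)
Section Bipyramid.
Variables (X Y : pseudo3) (p q : 'I_5).
Variables (old : 'I_5 -> tet X) (new : 'I_5 -> tet Y) (keep : tet X -> tet Y).

Definition pole (k : 'I_5) : bool := (k == p) || (k == q).

Definition in_S (t : tet X) : bool := [exists k, ~~ pole k && (t == old k)].

(* Correspondence between the faces of X not interior to S and those of Y not
   interior to S_e. *)
Definition face_corr (f : tet X * 'I_4) (f' : tet Y * 'I_4) : Prop :=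
  (~~ in_S f.1 /\ f' = (keep f.1, f.2)) \/
  exists k j, [/\ ~~ pole k, pole j, f.1 = old k /\ f'.1 = new j
    & lift k f.2 = j /\ lift j f'.2 = k].
End Bipyramid.

Record pachner32 (X Y : pseudo3) (e : edge X) := Pachner32 {
  p32 : 'I_5;
  q32 : 'I_5;
  old : 'I_5 -> tet X;
  new : 'I_5 -> tet Y;
  keep : tet X -> tet Y;
  pole_lt : (p32 < q32)%N;
  old_inj : forall j k, ~~ pole p32 q32 j -> ~~ pole p32 q32 k ->
    old j = old k -> j = k;
  new_inj : new p32 <> new q32;
  keep_inj : forall t t', ~~ in_S p32 q32 old t -> ~~ in_S p32 q32 old t' ->
    keep t = keep t' -> t = t';
  keep_new : forall t k, ~~ in_S p32 q32 old t -> pole p32 q32 k ->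
    keep t <> new k;
  tet_cover : forall t', (exists2 k, pole p32 q32 k & t' = new k) \/
    (exists2 t, ~~ in_S p32 q32 old t & t' = keep t);
  sgn_keep : forall t, ~~ in_S p32 q32 old t -> sgn (keep t) = sgn t;
  sgn_S : exists s : bool,
    (forall k, ~~ pole p32 q32 k -> sgn (old k) = s (+) odd k) /\
    (forall k, pole p32 q32 k -> sgn (new k) = ~~ s (+) odd k);
  edge_S : forall k (x : tedge), ~~ pole p32 q32 k ->
    lift k (val x).1 = p32 -> lift k (val x).2 = q32 -> phi (old k, x) = e;
  glue_old : forall j k i i', ~~ pole p32 q32 j -> ~~ pole p32 q32 k ->
    lift k i = j -> lift j i' = k -> glue (old k, i) = Some (old j, i');
  glue_new : forall i i', lift p32 i = q32 -> lift q32 i' = p32 ->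
    glue (new p32, i) = Some (new q32, i');
  glue_outer : forall f f', face_corr p32 q32 old new keep f f' ->
    if glue f is Some h
    then exists2 h', face_corr p32 q32 old new keep h h' & glue f' = Some h'
    else glue f' = None }.

Definition vlabel (k : 'I_5) (x : tedge) : {set 'I_5} :=
  finset (pred2 (lift k (val x).1) (lift k (val x).2)).

(* The graph of $\tilde P$.  If j, j' are the two poles and u, v, w the
   equatorial vertices, then in the new tetrahedron omitting j the edge j'u and
   its opposite edge vw carry the sum of the angles at the edge j'u of the old
   tetrahedra omitting v and w.  Numbering the old tetrahedra so that t_i and
   t_k (i, k distinct) share the triangle through e and a given equatorial
   vertex, these are the sums beta_i + gamma_k, and opposite edges of a
   generalized shape structure carry equal values. *)
Definition pachner_angles (R : realType) (X Y : pseudo3) (e : edge X)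
    (m : pachner32 Y e) (al : gshape R X) (al' : gshape R Y) : Prop :=
  (forall t x, ~~ in_S (p32 m) (q32 m) (old m) t ->
     al' (keep m t, x) = al (t, x)) /\
  (forall j j' u v w (x y z : tedge),
     uniq [:: j; j'; u; v; w] ->
     pole (p32 m) (q32 m) j -> pole (p32 m) (q32 m) j' ->
     vlabel j x = finset (pred2 j' u) \/ vlabel j x = finset (pred2 v w) ->
     vlabel v y = finset (pred2 j' u) -> vlabel w z = finset (pred2 j' u) ->
     al' (new m j, x) = al (old m v, y) + al (old m w, z)).

(* [h] is the map induced on gauge classes by $\tilde P$. *)
Definition pachner_induced (R : realType) (X Y : pseudo3) (e : edge X)
    (m : pachner32 Y e) (h : Sr R X -> Sr R Y) : Prop :=
  forall al : gshape R X, weight al e = 2 * pi ->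
    exists2 al' : gshape R Y, pachner_angles m al al' & h (cls _ al) = cls _ al'.

Definition pachner_level (R : realType) (X : pseudo3) (e : edge X)
    (al : gshape R X) (lX lY : R) : Prop :=
  lY = lX + (12%:R * pi)^-1 *
    \sum_(a : tetedge X | phi a == e) \sum_(b : tetedge X)
      eps R (opp_pair a) (opp_pair b) * al b.

(* Main.v *)
(* A gauge function is encoded by its pull-back G to the pairs (tetrahedron,
   edge), i.e. by a function that agrees along glued faces and vanishes on
   unglued ones; a gauge transformation is then alpha' = alpha + pi J G, where J
   is the matrix eps.  The pairing of G and H under eps is a sum over faces, in
   which the two sides of a glued face cancel because gluings reverse
   orientation; so it vanishes on gauge functions.  This makes gauge
   equivalence of leveled shapes transitive and weights gauge invariant.

   The map P of the move is linear and satisfies P J P^T = J and P J G = J G',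
   where G' is the restriction of G to the edges other than e.  Its kernel on
   tangent vectors is spanned by J chi, the gauge direction of e, and it has a
   linear section; so it induces a diffeomorphism on gauge classes.  It is
   Poisson since a bracket at a point is the derivative of one function along
   the Hamiltonian vector field of the other, which is tangent both to the
   shape structures and, because J chi is a gauge direction, to the level set
   of the weight of e. *)
From HB Require Import structures.
From mathcomp Require Import all_boot all_order all_algebra.
From mathcomp Require Import boolp classical_sets functions reals topology.
From mathcomp Require Import normedtype derive trigo.
From mathcomp Require Import zify ring lra.
Require Import Defs.

Set Implicit Arguments.
Unset Strict Implicit.
Unset Printing Implicit Defensive.

Import Order.TTheory GRing.Theory Num.Theory numFieldNormedType.Exports.
Local Open Scope ring_scope.

(** Outer faces of S may be glued to each other, so distinct edges of the bipyramid may be one edge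
    of X. Local formulas are therefore stated for functions on pairs (tetrahedron, edge), where the
    labels in ['I_5] stay distinct. In these labels the sign of eps is an orientation sign times the
    sign of a permutation of the five labels, so an identity is checked for one arrangement of poles
    and equatorial vertices and holds for all by symmetry.

    P alone does not respect levels: a gauge function on X and its restriction to Y change the level
    by amounts that differ by one twelfth of the pairing of J chi with J G. Up to sign, this pairing
    is also the variation of a linear function of the angles, the sum of J alpha over the pairs
    lying above e, divided by pi. Shifting the level by this function with the factor 1 / (12 pi)
    therefore gives a map on classes; the shift is linear, hence smooth, and as it depends on the
    angles only, it commutes with translations of the level. *)

(** * Edges of a tetrahedron *)

(* The edge {i, j}; junk unless i and j are distinct and less than 4. *)
Definition mk_tedge (i j : nat) : tedge :=
  let E (i j : 'I_4) (h : (i < j)%N) : tedge := exist _ (i, j) h in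
  match i, j with
  | 0, 1 | 1, 0 => E (@Ordinal 4 0 isT) (@Ordinal 4 1 isT) isT
  | 0, 2 | 2, 0 => E (@Ordinal 4 0 isT) (@Ordinal 4 2 isT) isT
  | 0, 3 | 3, 0 => E (@Ordinal 4 0 isT) (@Ordinal 4 3 isT) isT
  | 1, 2 | 2, 1 => E (@Ordinal 4 1 isT) (@Ordinal 4 2 isT) isT
  | 1, 3 | 3, 1 => E (@Ordinal 4 1 isT) (@Ordinal 4 3 isT) isT
  | _, _ => E (@Ordinal 4 2 isT) (@Ordinal 4 3 isT) isT
  end.

Lemma mk_tedgeC i j : mk_tedge i j = mk_tedge j i.
Proof. by case: i => [|[|[|[|i]]]]; case: j => [|[|[|[|j]]]]. Qed.

Lemma mk_tedge_val (x : tedge) : mk_tedge (val x).1 (val x).2 = x.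
Proof.
case: x => -[[i hi] [j hj]] /= h; apply: val_inj => /=.
case: i hi h => [|[|[|[|i]]]] // hi; case: j hj => [|[|[|[|j]]]] // hj h /=;
  by congr (_, _); apply: val_inj.
Qed.

Definition six (V : nmodType) (F : tedge -> V) (a b c d : nat) : V :=
  F (mk_tedge a b) + F (mk_tedge c d) + F (mk_tedge a c) + F (mk_tedge b d) + F (mk_tedge a d) + F (mk_tedge b c).

Lemma sum_tedge (V : nmodType) (F : tedge -> V) : \sum_x F x = six F 0 1 2 3.
Proof.
rewrite (perm_big [:: mk_tedge 0 1; mk_tedge 2 3; mk_tedge 0 2; mk_tedge 1 3; mk_tedge 0 3; mk_tedge 1 2]) /=.
  by rewrite !big_cons big_nil addr0 /six !addrA.
apply: uniq_perm => //; first exact: index_enum_uniq.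
move=> x; rewrite mem_index_enum -(mk_tedge_val x).
case: x => -[[i hi] [j hj]] /= h.
by case: i hi h => [|[|[|[|i]]]] // hi; case: j hj => [|[|[|[|j]]]] // hj h.
Qed.

Lemma sum_tedge4 (R : comPzRingType) (F : tedge -> R) (a b c d : nat) :
  uniq [:: a; b; c; d] -> all (gtn 4) [:: a; b; c; d] ->
  \sum_x F x = six F a b c d.
Proof.
rewrite sum_tedge /six.
by case: a => [|[|[|[|a]]]] //; case: b => [|[|[|[|b]]]] //;
  case: c => [|[|[|[|c]]]] //; case: d => [|[|[|[|d]]]] //= _ _; ring.
Qed.

Lemma sum_vertex (R : comPzRingType) (F : tedge -> R) (v : 'I_4) (b c d : nat) :
  uniq [:: val v; b; c; d] -> all (gtn 4) [:: b; c; d] ->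
  \sum_(x | ends x v) F x = F (mk_tedge v b) + F (mk_tedge v c) + F (mk_tedge v d).
Proof.
rewrite big_mkcond sum_tedge /six; case: v => v hv /=; rewrite /ends.
by case: v hv => [|[|[|[|a]]]] // hv; case: b => [|[|[|[|b]]]] //;
  case: c => [|[|[|[|c]]]] //; case: d => [|[|[|[|d]]]] //= _ _;
  rewrite /=; ring.
Qed.

(** * Tetrahedra labelled as faces of a 4-simplex *)

Lemma uniq5E (T : eqType) (k a b c d : T) : uniq [:: k; a; b; c; d] =
  [&& k != a, k != b, k != c, k != d, a != b, a != c, a != d, b != c, b != d & c != d].
Proof. by rewrite /= !inE !negb_or -!andbA andbT. Qed.

(** Distinctness of five labels listed in another order: each of the ten inequalities is among those
    of [h], up to symmetry. *)
Ltac uniq5 h := have := h; rewrite !uniq5E; do 9 (case/andP => ?); move=> ?;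
  do 9 (apply/andP; split; first by [|rewrite eq_sym]); by [|rewrite eq_sym].

Lemma fresh5 (s : seq 'I_5) : (size s < 5)%N -> exists x, x \notin s.
Proof.
move=> hs; apply/existsP; apply: contraTT hs => /existsPn h; rewrite -leqNgt.
have := uniq_leq_size (enum_uniq 'I_5) (s2 := s).
by rewrite size_enum_ord; apply => x _; apply/negPn/h.
Qed.

Lemma uniq_rcons (T : eqType) (s : seq T) x : uniq s -> x \notin s -> uniq (rcons s x).
Proof. by rewrite rcons_uniq => -> ->. Qed.

(* In the tetrahedron with vertex set 'I_5 minus k, the edge with ends a, b. *)
Definition te (k a b : 'I_5) : tedge := mk_tedge (unbump k a) (unbump k b).

Lemma teC k a b : te k a b = te k b a. Proof. exact: mk_tedgeC. Qed.

Lemma all_iota5 (P : nat -> bool) : all P (iota 0 5) -> forall k : 'I_5, P k.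
Proof. by move/allP => h k; apply: h; rewrite mem_iota /=. Qed.

(** The labels are naturals below 5 instead of elements of ['I_5], so that a statement about all
    arrangements of five labels is decided by evaluation. *)
Definition all5 (P : nat -> nat -> nat -> nat -> nat -> bool) : bool :=
  all (fun k => all (fun a => all (fun b => all (fun c => all (fun d =>
    uniq [:: k; a; b; c; d] ==> P k a b c d) (iota 0 5)) (iota 0 5)) (iota 0 5))
      (iota 0 5)) (iota 0 5).

Lemma all5P (P : nat -> nat -> nat -> nat -> nat -> bool) : all5 P ->
  forall k a b c d : 'I_5, uniq [:: k; a; b; c; d] -> P k a b c d.
Proof.
move=> /all_iota5 h k a b c d.
have /all_iota5 h1 := h k; have /all_iota5 h2 := h1 a.
have /all_iota5 h3 := h2 b; have /all_iota5 h4 := h3 c.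
have /implyP h5 := h4 d.
by rewrite -(map_inj_uniq val_inj) /= => /h5.
Qed.

Lemma unbump_uniq (k a b c d : 'I_5) : uniq [:: k; a; b; c; d] ->
  uniq [:: unbump k a; unbump k b; unbump k c; unbump k d] &&
  all (gtn 4) [:: unbump k a; unbump k b; unbump k c; unbump k d].
Proof.
apply: (all5P (P := fun k a b c d =>
  uniq [:: unbump k a; unbump k b; unbump k c; unbump k d] &&
  all (gtn 4) [:: unbump k a; unbump k b; unbump k c; unbump k d])).
by vm_compute.
Qed.

Lemma sum_label (R : comPzRingType) (F : tedge -> R) (k a b c d : 'I_5) :
  uniq [:: k; a; b; c; d] ->
  \sum_x F x = F (te k a b) + F (te k c d) + F (te k a c) + F (te k b d)
             + F (te k a d) + F (te k b c).
Proof. by move/unbump_uniq/andP => [h1 h2]; rewrite (sum_tedge4 _ h1). Qed.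

Definition eidx (x : tedge) : nat :=
  let: (i, j) := val x in if i == ord0 then j.-1 else (5 - i - j)%N.

(** The entry of [eps] in a positive tetrahedron, with integer values so that it computes; [epsE]
    makes the link. *)
Definition cyc (x y : tedge) : int :=
  (eidx y == (eidx x).+1 %% 3)%N%:R - (eidx x == (eidx y).+1 %% 3)%N%:R.

Definition cmp (a b : nat) : int := if (a < b)%N then 1 else if (b < a)%N then -1 else 0.

Lemma cmpC a b : cmp a b = - cmp b a.
Proof. by rewrite /cmp; case: ltngtP => //; rewrite ?opprK ?oppr0. Qed.

Lemma cmp_sqr (a b : nat) : a != b -> cmp a b * cmp a b = 1.
Proof. by rewrite /cmp; case: ltngtP. Qed.

(* The sign of the permutation (k, a, b, c, d) of 'I_5. *)
Definition sgn5 (k a b c d : nat) : int :=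
  cmp k a * cmp k b * cmp k c * cmp k d * (cmp a b * cmp a c * cmp a d)
  * (cmp b c * cmp b d) * cmp c d.

(** The sign [s] is that of the permutation sorting [a], [b], [c], [d]: exactly [k] labels are
    smaller than [k], so the four comparisons with [k] in [sgn5] multiply to [(-1) ^+ odd k]. This
    frees the cyclic order from the numbering of the vertices. All arrangements are checked by
    evaluation. *)
Lemma cyc_label (k a b c d : 'I_5) : uniq [:: k; a; b; c; d] ->
  let s := (-1) ^+ odd k * sgn5 k a b c d in
  [&& cyc (te k a b) (te k a b) == 0, cyc (te k a b) (te k c d) == 0,
      cyc (te k a b) (te k a c) == s, cyc (te k a b) (te k b d) == s,
      cyc (te k a b) (te k a d) == - s & cyc (te k a b) (te k b c) == - s].
Proof.
move=> h; apply: (all5P (P := fun k a b c d =>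
  let te k a b := mk_tedge (unbump k a) (unbump k b) in
  let s := (-1) ^+ odd k * sgn5 k a b c d in
  [&& cyc (te k a b) (te k a b) == 0, cyc (te k a b) (te k c d) == 0,
      cyc (te k a b) (te k a c) == s, cyc (te k a b) (te k b d) == s,
      cyc (te k a b) (te k a d) == - s & cyc (te k a b) (te k b c) == - s])) => //.
Qed.

Lemma eidx_label (k a b c d : 'I_5) : uniq [:: k; a; b; c; d] ->
  eidx (te k a b) = eidx (te k c d).
Proof.
move=> h; apply/eqP; apply: (all5P (P := fun k a b c d =>
  eidx (mk_tedge (unbump k a) (unbump k b)) == eidx (mk_tedge (unbump k c) (unbump k d)))) => //.
Qed.

Lemma eidx_lt x : (eidx x < 3)%N.
Proof.
rewrite -(mk_tedge_val x); case: x => -[[i hi] [j hj]] /= h.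
by case: i hi h => [|[|[|[|i]]]] // hi; case: j hj => [|[|[|[|j]]]] // hj h.
Qed.

(** * The operator of eps and vertex sums *)

Section Tets.
Variables (R : realType) (X : pseudo3).
Implicit Types (A B G : tetedge X -> R) (t : tet X).

Definition sg t : R := (-1) ^+ (~~ sgn t).

Lemma opp_pairE (a : tetedge X) : opp_pair a = (a.1, inord (eidx a.2)).
Proof. by rewrite /opp_pair /eidx; case: (val a.2). Qed.

Lemma epsE (a b : tetedge X) : eps R (opp_pair a) (opp_pair b) =
  if a.1 == b.1 then sg a.1 * (cyc a.2 b.2)%:~R else 0.
Proof.
rewrite !opp_pairE /eps /=; case: ifP => // _; congr (_ * _).
rewrite /cyc rmorphB /=; rewrite -!val_eqE /=.
by rewrite !inordK ?eidx_lt // !rmorph_nat.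
Qed.

Lemma eps_anti (a b : oppedges X) : eps R a b = - eps R b a.
Proof.
rewrite /eps eq_sym; case: eqP => [->|_]; last by rewrite oppr0.
by rewrite -mulrN opprB.
Qed.

Definition J G (a : tetedge X) : R :=
  \sum_(b : tetedge X) eps R (opp_pair a) (opp_pair b) * G b.

Lemma sum_tetedge A : \sum_a A a = \sum_t \sum_x A (t, x).
Proof. by rewrite pair_big /=; apply: eq_bigr => -[]. Qed.

Lemma J_local G t x : J G (t, x) = sg t * \sum_y (cyc x y)%:~R * G (t, y).
Proof.
rewrite /J sum_tetedge (bigD1 t) //= [X in _ + X]big1 ?addr0.
  by rewrite big_distrr; apply: eq_bigr => y _; rewrite epsE /= eqxx mulrA.
move=> t' h; apply: big1 => y _.
by rewrite epsE /= eq_sym (negbTE h) mul0r.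
Qed.

Lemma J_label G t (k a b c d : 'I_5) : uniq [:: k; a; b; c; d] ->
  J G (t, te k a b) = sg t * (-1) ^+ odd k * (sgn5 k a b c d)%:~R *
    (G (t, te k a c) + G (t, te k b d) - G (t, te k a d) - G (t, te k b c)).
Proof.
move=> h; rewrite J_local (sum_label _ h).
have /and5P[/eqP-> /eqP-> /eqP-> /eqP-> /andP[/eqP-> /eqP->]] := cyc_label h.
by rewrite !(rmorphN, rmorphM) /= rmorphXn /= rmorphN1; ring.
Qed.

Lemma J_opp G t (k a b c d : 'I_5) : uniq [:: k; a; b; c; d] ->
  J G (t, te k a b) = J G (t, te k c d).
Proof.
by move=> h; apply: eq_bigr => b' _; rewrite !opp_pairE /= (eidx_label h).
Qed.

Lemma J_skew A B : \sum_a A a * J B a = - \sum_a B a * J A a.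
Proof.
have E C D : \sum_a C a * J D a =
    \sum_a \sum_b C a * eps R (opp_pair a) (opp_pair b) * D b.
  by apply: eq_bigr => a _; rewrite big_distrr; apply: eq_bigr => b _ /=; rewrite mulrA.
rewrite !E exchange_big -sumrN; apply: eq_bigr => a _.
rewrite -sumrN; apply: eq_bigr => b _.
by rewrite eps_anti; ring.
Qed.

Lemma J_lin c A B a : J (fun x => c * A x + B x) a = c * J A a + J B a.
Proof.
rewrite /J big_distrr -big_split; apply: eq_bigr => b _ /=; ring.
Qed.

Definition vsum A t (v : 'I_4) : R := \sum_(x | ends x v) A (t, x).

Lemma vsumE A t v : \sum_(a : tetedge X | (a.1 == t) && ends a.2 v) A a = vsum A t v.
Proof.
rewrite big_mkcond sum_tetedge (bigD1 t) //= [X in _ + X]big1 ?addr0.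
  by rewrite /vsum [RHS]big_mkcond; apply: eq_bigr => x _; rewrite eqxx.
by move=> t' /negbTE h; apply: big1 => x _; rewrite h.
Qed.

(** The direction space of the affine space of generalized shape structures. *)
Definition vtangent A := forall t v, vsum A t v = 0.

Lemma vsum_lin c A B t v : vsum (fun x => c * A x + B x) t v = c * vsum A t v + vsum B t v.
Proof. by rewrite /vsum big_distrr -big_split. Qed.

Lemma vsum_label A t (k a b c d : 'I_5) (v : 'I_4) : uniq [:: k; a; b; c; d] ->
  lift k v = a ->
  vsum A t v = A (t, te k a b) + A (t, te k a c) + A (t, te k a d).
Proof.
move=> h hv; have /andP[h1 h2] := unbump_uniq h.
have E : unbump k a = val v by rewrite -hv /= bumpK.
rewrite /vsum (sum_vertex _ (b := unbump k b) (c := unbump k c) (d := unbump k d)).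
- by rewrite /te E.
- by rewrite -E.
- by move: h2 => /= /andP[].
Qed.

(** The three edges at a vertex represent the three opposite pairs. By [J_label], each of the six
    values of [G] enters exactly two of the three rows, with opposite signs. *)
Lemma J_vtangent G : vtangent (J G).
Proof.
move=> t v.
(* The tetrahedron is viewed as the face of the 4-simplex omitting [ord_max]; any other label could
   be omitted instead. *)
have [a ha] : exists a, lift (ord_max : 'I_5) v = a by eexists.
have ua : uniq [:: ord_max; a] by rewrite /= inE -ha neq_lift.
have [b /(uniq_rcons ua) ub] : exists x, x \notin [:: ord_max; a] by exact: fresh5.
have [c /(uniq_rcons ub) uc] : exists x, x \notin [:: ord_max; a; b] by exact: fresh5.
have [d /(uniq_rcons uc) h] : exists x, x \notin [:: ord_max; a; b; c] by exact: fresh5.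
rewrite (vsum_label _ _ h ha).
have h1 : uniq [:: ord_max; a; c; b; d] by uniq5 h.
have h2 : uniq [:: ord_max; a; d; b; c] by uniq5 h.
rewrite (J_label _ _ h) (J_label _ _ h1) (J_label _ _ h2).
rewrite /sgn5 (cmpC c b) (cmpC d b) (cmpC d c) (teC _ c b) (teC _ d b) (teC _ d c).
by rewrite !(rmorphM, rmorphN) /=; ring.
Qed.
End Tets.

(** * Gauge transformations *)

Lemma val_mk_tedge (i j : 'I_4) : (i < j)%N -> val (mk_tedge i j) = (i, j).
Proof. by move=> h; have /= -> := mk_tedge_val (exist _ (i, j) h). Qed.

Lemma lift_lt n (i : 'I_n) (z1 z2 : 'I_n.-1) :
  (lift i z1 < lift i z2)%N = (z1 < z2)%N.
Proof. by rewrite /= /bump; do 2!case: leqP => /= *; lia. Qed.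

Section Gauges.
Variables (R : realType) (X : pseudo3).
Implicit Types (A B G H : tetedge X -> R) (t : tet X) (f : tet X * 'I_4).

(** The ends are numbered inside the face: as gluings preserve the order, corresponding edges of two
    glued faces have the same [z1] and [z2]. *)
Definition face_edge f (z1 z2 : 'I_3) : tetedge X := (f.1, mk_tedge (lift f.2 z1) (lift f.2 z2)).

Lemma face_edgeC f z1 z2 : face_edge f z1 z2 = face_edge f z2 z1.
Proof. by rewrite /face_edge mk_tedgeC. Qed.

Definition isgauge G := forall f z1 z2, z1 != z2 ->
  G (face_edge f z1 z2) = if glue f is Some f' then G (face_edge f' z1 z2) else 0.

Lemma val_face_edge f (z1 z2 : 'I_3) : (z1 < z2)%N ->
  val (face_edge f z1 z2).2 = (lift f.2 z1, lift f.2 z2).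
Proof. by move=> h; rewrite /face_edge val_mk_tedge // lift_lt. Qed.

Lemma isgauge_lin c G H : isgauge G -> isgauge H -> isgauge (fun a => c * G a + H a).
Proof.
move=> hG hH f z1 z2 hz; have := hG f z1 z2 hz; have := hH f z1 z2 hz.
by case: (glue f) => [f'|] -> ->; rewrite ?mulr0 ?addr0.
Qed.

Lemma isgauge0 : isgauge (fun=> 0).
Proof. by move=> f z1 z2 _; case: (glue f). Qed.

Lemma eglue_face_edge f f' (z1 z2 : 'I_3) : glue f = Some f' -> (z1 < z2)%N ->
  eglue (face_edge f z1 z2) (face_edge f' z1 z2).
Proof.
move=> h hz; apply/existsP; exists f.2; apply/existsP; exists f'.2.
apply/existsP; exists (z1, z2).
by rewrite !val_face_edge // -!surjective_pairing h !eqxx.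
Qed.

Lemma eglueP (a b : tetedge X) : eglue a b -> exists f f' (z1 z2 : 'I_3),
  [/\ glue f = Some f', (z1 < z2)%N, a = face_edge f z1 z2 & b = face_edge f' z1 z2].
Proof.
case/existsP => i /existsP[i' /existsP[[z1 z2] /and3P[/eqP h /eqP h1 /eqP h2]]].
exists (a.1, i), (b.1, i'), z1, z2; split => //.
- by have := valP a.2; rewrite h1 lift_lt.
- by rewrite {1}(surjective_pairing a) -(mk_tedge_val a.2) h1.
- by rewrite {1}(surjective_pairing b) -(mk_tedge_val b.2) h2.
Qed.

Lemma eglue_sym : symmetric (@eglue X).
Proof.
move=> a b; apply/idP/idP => /eglueP[f [f' [z1 [z2 [h hz -> ->]]]]];
  exact: eglue_face_edge (glue_sym h) hz.
Qed.

Lemma eglue_phi (a b : tetedge X) : eglue a b -> phi a = phi b.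
Proof.
move=> h; apply: val_inj => /=; apply/setP => c; rewrite !inE.
by apply: same_connect; [apply: sym_connect_sym; apply: eglue_sym | exact: connect1].
Qed.

Lemma face_edge_of (a : tetedge X) (i : 'I_4) : ~~ ends a.2 i ->
  exists z1 z2, z1 != z2 /\ a = face_edge (a.1, i) z1 z2.
Proof.
rewrite /ends negb_or => /andP[/unlift_some[z1 h1 _] /unlift_some[z2 h2 _]].
exists z1, z2; split.
  by apply: contraTneq (valP a.2) => z12; rewrite h1 h2 z12 ltnn.
by rewrite {1}(surjective_pairing a) -(mk_tedge_val a.2) h1 h2.
Qed.

Lemma isgauge_phi (g : edge X -> R) :
  (forall e, bd_edge e -> g e = 0) -> isgauge (g \o @phi X).
Proof.
move=> hg f z1 z2; wlog hz : z1 z2 / (z1 < z2)%N => [th hz|_] /=.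
  have := hz; rewrite neq_ltn => /orP[] h; first exact: th.
  by rewrite face_edgeC /= in th *; rewrite th // 1?eq_sym //; case: (glue f) => // f'; rewrite face_edgeC.
case h: (glue f) => [f'|]; first by congr g; apply/eglue_phi/eglue_face_edge.
apply: hg; apply/existsP; exists (face_edge f z1 z2); rewrite eqxx /=.
apply/existsP; exists f.2; rewrite -surjective_pairing h eqxx.
by rewrite /ends val_face_edge // negb_or !neq_lift.
Qed.

(** Agreement across glued faces makes [G] constant on the classes of [connect], so it factors
    through the edges of X; an unpaired face forces the value 0 on its edges. *)
Lemma isgauge_edge G : isgauge G ->
  exists2 g : edge X -> R, forall e, bd_edge e -> g e = 0 & forall a, G a = g (phi a).
Proof.
move=> hG.
have Gc a b : connect (@eglue X) a b -> G a = G b.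
  case/connectP => s + ->; elim: s a => //= c s IH a /andP[/eglueP].
  case=> [f [f' [z1 [z2 [h hz -> ->]]]]] /IH <-.
  by rewrite hG ?h // neq_ltn hz.
pose r (e : edge X) := xchoose (existsP (valP e)).
have rP a : G (r (phi a)) = G a.
  have /eqP := xchooseP (existsP (valP (phi a))); rewrite -/(r _) /= => h.
  by apply/esym/Gc; have := connect0 (@eglue X) (r (phi a)); rewrite -[connect _ _ _]inE -/(eclass _) -h inE.
exists (G \o r) => [e /existsP[a /andP[/eqP<-]]|a] /=; last by rewrite rP.
case/existsP => i /andP[/eqP h /face_edge_of[z1 [z2 [hz ea]]]].
by rewrite rP ea hG // h.
Qed.

Definition lev G A : R := \sum_a G a * (3%:R^-1 - A a / pi).

Lemma gauge_levelE (g : edge X -> R) (al : gshape R X) :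
  gauge_level g al = lev (g \o @phi X) al.
Proof.
rewrite /lev (partition_big (@phi X) xpredT) //=; apply: eq_bigr => e _.
by rewrite big_distrr; apply: eq_bigr => a /eqP <-.
Qed.

Lemma lgauge_equivP (x x' : lgshape R X) : lgauge_equiv x x' <->
  exists G, [/\ isgauge G, forall a, x'.1 a = x.1 a + pi * J G a &
    x'.2 = x.2 + lev G x.1].
Proof.
split=> [[g hg [h1 h2]]|[G [/isgauge_edge[g hg hG] h1 h2]]].
  exists (g \o @phi X); split => //; first exact: isgauge_phi.
  by rewrite h2 gauge_levelE.
have eG : G = g \o @phi X by apply/funext => a; rewrite hG.
by exists g => //; split; [rewrite eG in h1 | rewrite h2 gauge_levelE eG].
Qed.

Lemma gauge_equivP (al al' : gshape R X) : gauge_equiv al al' <->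
  exists2 G, isgauge G & forall a, al' a = al a + pi * J G a.
Proof.
split=> [[g hg h1]|[G /isgauge_edge[g hg hG] h1]].
  by exists (g \o @phi X) => //; exact: isgauge_phi.
have eG : G = g \o @phi X by apply/funext => a; rewrite hG.
by exists g => //; rewrite eG in h1.
Qed.

(* The contribution of the face [f] to the pairing of [G] and [H] under eps;
   glued faces contribute with opposite signs. *)
Definition fpair G H f : R :=
  let e01 := face_edge f (inord 0) (inord 1) in
  let e02 := face_edge f (inord 0) (inord 2) in
  let e12 := face_edge f (inord 1) (inord 2) in
  G e01 * (H e02 - H e12) + G e02 * (H e12 - H e01) + G e12 * (H e01 - H e02).

(** Two edges with nonzero [eps] share one vertex, hence lie in a unique face. This sorts the
    pairing inside a tetrahedron by faces; up to a common sign, each face enters with its boundary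
    orientation. *)
Lemma J_faces G H t : \sum_x G (t, x) * J H (t, x) =
  - \sum_(i : 'I_4) sg R t * (-1) ^+ odd i * fpair G H (t, i).
Proof.
under eq_bigr do rewrite J_local.
rewrite sum_tedge /six !sum_tedge /six.
rewrite !big_ord_recl big_ord0 /fpair /face_edge /= !inordK //= /bump /=.
repeat match goal with |- context [cyc ?x ?y] =>
  let v := eval vm_compute in (cyc x y) in change (cyc x y) with v end.
rewrite ?(NegzE, mulrNz, mulr0z, mulr1z); ring.
Qed.

Lemma J_isgauge G H : isgauge G -> isgauge H -> \sum_a G a * J H a = 0.
Proof.
move=> hG hH; rewrite sum_tetedge.
under eq_bigr do rewrite J_faces.
pose N f := sg R f.1 * (-1) ^+ odd f.2 * fpair G H f.
rewrite sumrN pair_big /=; apply/eqP; rewrite oppr_eq0; apply/eqP.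
have -> : \sum_(f : tet X * 'I_4) sg R f.1 * (-1) ^+ odd f.2 * fpair G H (f.1, f.2) = \sum_f N f.
  by apply: eq_bigr => -[].
(* [inv] exchanges the two sides of a glued face and fixes an unpaired one, where both gauge
   functions vanish. *)
pose inv f := odflt f (glue f).
have invK : involutive inv.
  move=> f; rewrite /inv; case h: (glue f) => [f'|] /=; last by rewrite h.
  by rewrite (glue_sym h).
have Ninv f : N (inv f) = - N f.
  have z01 : inord 0 != inord 1 :> 'I_3 by rewrite -val_eqE /= !inordK.
  have z02 : inord 0 != inord 2 :> 'I_3 by rewrite -val_eqE /= !inordK.
  have z12 : inord 1 != inord 2 :> 'I_3 by rewrite -val_eqE /= !inordK.
  rewrite /N /inv /fpair !(hG _ _ _ z01) !(hG _ _ _ z02) !(hG _ _ _ z12).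
  rewrite !(hH _ _ _ z01) !(hH _ _ _ z02) !(hH _ _ _ z12).
  case h: (glue f) => [f'|] /=; last by rewrite h; ring.
  rewrite (glue_sym h); have := hH f _ _ z01; have := hH f _ _ z02; have := hH f _ _ z12.
  have := hG f _ _ z01; have := hG f _ _ z02; have := hG f _ _ z12.
  rewrite h => <- <- <- <- <- <-.
  have : sg R f'.1 * (-1) ^+ odd f'.2 = - (sg R f.1 * (-1) ^+ odd f.2).
    rewrite /sg; have := glue_rev h.
    by case: (sgn _); case: (sgn _); case: (odd _); case: (odd _) => //= _; rewrite !(expr0, expr1); ring.
  by move=> ->; rewrite mulNr.
have : \sum_f N f = - \sum_f N f.
  rewrite -sumrN {1}(reindex_inj (can_inj invK)) /=.
  by apply: eq_bigr => f _; rewrite Ninv.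
by move=> h; lra.
Qed.

Lemma lev_lin c G H A : lev (fun a => c * G a + H a) A = c * lev G A + lev H A.
Proof.
by rewrite /lev big_distrr -big_split; apply: eq_bigr => a _ /=; rewrite mulrDl mulrA.
Qed.

(** The two sides differ by [- \sum_a G a * J H a], since the factor [pi] of the gauge action
    cancels the division by [pi] in [lev]; this pairing vanishes on gauge functions. *)
Lemma lev_gauge G H A B : isgauge G -> isgauge H ->
  (forall a, B a = A a + pi * J H a) -> lev G B = lev G A.
Proof.
move=> hG hH h; apply/eqP; rewrite -subr_eq0 -(oppr0 R) -(J_isgauge hG hH).
rewrite /lev -sumrB -sumrN; apply/eqP; apply: eq_bigr => a _; rewrite h.
have /lt0r_neq0 hpi := pi_gt0 R.
by move: pi hpi => c hc; field.
Qed.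

Lemma gauge_equiv_refl (al : gshape R X) : gauge_equiv al al.
Proof.
apply/gauge_equivP; exists (fun=> 0) => [|a]; first exact: isgauge0.
by rewrite /J big1 ?mulr0 ?addr0 // => b _; rewrite mulr0.
Qed.

Lemma J0 (a : tetedge X) : J (fun=> 0 : R) a = 0.
Proof. by rewrite /J big1 // => b _; rewrite mulr0. Qed.

(** The negative is written as a linear combination to match [J_lin] and [lev_lin]. *)
Lemma isgaugeN G : isgauge G -> isgauge (fun a => -1 * G a + 0).
Proof. by move=> h; apply: isgauge_lin => //; exact: isgauge0. Qed.

Lemma gauge_equiv_sym (al al' : gshape R X) : gauge_equiv al al' -> gauge_equiv al' al.
Proof.
case/gauge_equivP => G hG h; apply/gauge_equivP.
by exists (fun a => -1 * G a + 0) => [|a]; [exact: isgaugeN | rewrite J_lin J0 h; ring].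
Qed.

Lemma gauge_equiv_trans (al be ga : gshape R X) :
  gauge_equiv al be -> gauge_equiv be ga -> gauge_equiv al ga.
Proof.
case/gauge_equivP => G hG h /gauge_equivP[H hH h']; apply/gauge_equivP.
by exists (fun a => 1 * G a + H a) => [|a]; [exact: isgauge_lin | rewrite J_lin h' h; ring].
Qed.

Lemma lgauge_equiv_refl (x : lgshape R X) : lgauge_equiv x x.
Proof.
apply/lgauge_equivP; exists (fun=> 0); split => [|a|]; first exact: isgauge0.
  by rewrite J0 mulr0 addr0.
by rewrite /lev big1 ?addr0 // => a _; rewrite mul0r.
Qed.

Lemma lgauge_equiv_sym (x y : lgshape R X) : lgauge_equiv x y -> lgauge_equiv y x.
Proof.
case/lgauge_equivP => G [hG h1 h2]; apply/lgauge_equivP.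
exists (fun a => -1 * G a + 0); split => [|a|]; first exact: isgaugeN.
  by rewrite J_lin J0 h1; ring.
rewrite lev_lin (lev_gauge hG hG h1) h2 [lev (fun=> 0) _]big1; first ring.
by move=> a _; rewrite mul0r.
Qed.

Lemma lgauge_equiv_trans (x y z : lgshape R X) :
  lgauge_equiv x y -> lgauge_equiv y z -> lgauge_equiv x z.
Proof.
case/lgauge_equivP => G [hG h1 h2] /lgauge_equivP[H [hH h3 h4]]; apply/lgauge_equivP.
exists (fun a => 1 * G a + H a); split => [|a|]; first exact: isgauge_lin.
  by rewrite J_lin h3 h1; ring.
by rewrite lev_lin h4 h2 (lev_gauge hH hG h1); ring.
Qed.
End Gauges.

(** * Quotient sets and the two gauge quotients *)

Section Quotients.
Variables (T : Type) (r : T -> T -> Prop).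
Hypothesis r_refl : forall x, r x x.
Hypothesis r_sym : forall x y, r x y -> r y x.
Hypothesis r_trans : forall x y z, r x y -> r y z -> r x z.

Lemma cls_eq x y : cls r x = cls r y <-> r x y.
Proof.
split=> [[e]|h]; first by rewrite e.
by apply: eq_exist; apply/funext => z; apply/propext; split; apply: r_trans => //; exact: r_sym.
Qed.

Lemma cls_rep (c : quot r) : cls r (rep c) = c.
Proof.
case: c => C hC; apply: eq_exist; rewrite /rep /=.
by case: cid => x /= ->.
Qed.

End Quotients.

Section Classes.
Variables (R : realType) (X : pseudo3).

Lemma cls_gauge (al be : gshape R X) :
  cls (@gauge_equiv R X) al = cls (@gauge_equiv R X) be <-> gauge_equiv al be.
Proof.
by apply: cls_eq; [exact: gauge_equiv_refl|exact: gauge_equiv_sym|exact: gauge_equiv_trans].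
Qed.

Lemma cls_lgauge (x y : lgshape R X) :
  cls (@lgauge_equiv R X) x = cls (@lgauge_equiv R X) y <-> lgauge_equiv x y.
Proof.
by apply: cls_eq; [exact: lgauge_equiv_refl|exact: lgauge_equiv_sym|exact: lgauge_equiv_trans].
Qed.

Lemma LSproj_cls (x : lgshape R X) : LSproj (cls (@lgauge_equiv R X) x) = cls _ x.1.
Proof.
apply/cls_gauge/gauge_equivP.
have /cls_lgauge/lgauge_equivP[G [hG h _]] := cls_rep (cls (@lgauge_equiv R X) x).
by exists G.
Qed.

Lemma LStrans_cls s (x : lgshape R X) :
  LStrans s (cls (@lgauge_equiv R X) x) = cls _ (x.1, x.2 + s).
Proof.
apply/cls_lgauge.
have /cls_lgauge/lgauge_equivP[G [hG h1 h2]] := esym (cls_rep (cls (@lgauge_equiv R X) x)).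
apply/lgauge_equiv_sym/lgauge_equivP; exists G; split => //=.
by rewrite h2; ring.
Qed.
End Classes.

(** * Labellings of the bipyramid *)

Lemma te_lift k (x : tedge) : x = te k (lift k (val x).1) (lift k (val x).2).
Proof. by rewrite /te /= !bumpK mk_tedge_val. Qed.

Lemma te_labels (k a b : 'I_5) : a != b -> k != a -> k != b ->
  let x := te k a b in
  (lift k (val x).1 = a /\ lift k (val x).2 = b) \/
  (lift k (val x).1 = b /\ lift k (val x).2 = a).
Proof.
move=> hab /unlift_some[a' ea _] /unlift_some[b' eb _] /=.
have -> : te k a b = mk_tedge a' b' by rewrite /te ea eb /= !bumpK.
have : a' != b' by apply: contraNneq hab => h; rewrite ea eb h.
rewrite neq_ltn => /orP[] h; last rewrite mk_tedgeC; rewrite val_mk_tedge //=; [left|right]; by split.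
Qed.

(** Both sides enumerate increasingly the three labels other than [j] and [k]. Hence two tetrahedra
    of the bipyramid give the vertices of their common face the same labels. *)
Lemma lift_lift (j k : 'I_5) (i i' : 'I_4) (z : 'I_3) :
  lift k i = j -> lift j i' = k -> lift k (lift i z) = lift j (lift i' z).
Proof.
move=> /(congr1 val) /= h1 /(congr1 val) /= h2; apply: val_inj => /=.
move: h1 h2; rewrite /bump; do !(case: leqP => ?); lia.
Qed.

Section Bipyramid.
Variables (X Y : pseudo3) (e : edge X) (m : pachner32 Y e).

Notation P := (pole (p32 m) (q32 m)).
Notation inS := (in_S (p32 m) (q32 m) (old m)).

(* j, j' are the poles and u, v, w the equatorial vertices. *)
Definition arr (j j' u v w : 'I_5) : bool :=
  uniq [:: j; j'; u; v; w] && (P j && P j').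

Lemma arr_uniq j j' u v w : arr j j' u v w -> uniq [:: j; j'; u; v; w].
Proof. by case/andP. Qed.

Lemma arr_neq j j' u v w : arr j j' u v w ->
  [&& j != j', j != u, j != v, j != w, j' != u, j' != v, j' != w, u != v, u != w & v != w].
Proof. by move/arr_uniq; rewrite uniq5E. Qed.

Lemma pole_cases j j' k : P j -> P j' -> j != j' -> P k -> k = j \/ k = j'.
Proof.
by move=> /orP[]/eqP-> /orP[]/eqP-> h /orP[]/eqP->;
  first [by left | by right | by rewrite eqxx in h].
Qed.

Lemma arr_P j j' u v w : arr j j' u v w ->
  [/\ P j, P j', ~~ P u, ~~ P v & ~~ P w].
Proof.
move=> h; have /and3P[_ hj hj'] := h.
have N k : j != j' -> j != k -> j' != k -> ~~ P k.
  by move=> hjj h1 h2; apply/negP => /(pole_cases hj hj' hjj)[] E; rewrite E eqxx in h1 h2.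
by move: (arr_neq h); do 9 (case/andP => ?); move=> ?; split => //; apply: N.
Qed.

Lemma arr_swap j j' u v w : arr j j' u v w -> arr j' j u v w.
Proof. by move=> /andP[h /andP[h1 h2]]; rewrite /arr h1 h2 !andbT; uniq5 h. Qed.

Lemma arr_rot j j' u v w : arr j j' u v w -> arr j j' v w u.
Proof. by move=> /andP[h /andP[h1 h2]]; rewrite /arr h1 h2 !andbT; uniq5 h. Qed.

Lemma arr_flip j j' u v w : arr j j' u v w -> arr j j' u w v.
Proof. by move=> /andP[h /andP[h1 h2]]; rewrite /arr h1 h2 !andbT; uniq5 h. Qed.

Lemma P_p : P (p32 m). Proof. by rewrite /pole eqxx. Qed.
Lemma P_q : P (q32 m). Proof. by rewrite /pole eqxx orbT. Qed.
Lemma pq_neq : p32 m != q32 m.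
Proof. by have := pole_lt m; rewrite neq_ltn => ->. Qed.

Lemma pole_other j : P j -> exists2 j', P j' & j != j'.
Proof.
move=> /orP[/eqP->|/eqP->]; first by exists (q32 m); rewrite ?P_q ?pq_neq.
by exists (p32 m); rewrite ?P_p // eq_sym pq_neq.
Qed.

Lemma pole_neq j u : P j -> ~~ P u -> j != u.
Proof. by move=> hj; apply: contraNneq => <-. Qed.

Lemma arr_ex1 j j' : P j -> P j' -> j != j' -> exists u v w, arr j j' u v w.
Proof.
move=> hj hj' h; have u0 : uniq [:: j; j'] by rewrite /= inE h.
have [b /(uniq_rcons u0) ub] : exists x, x \notin [:: j; j'] by exact: fresh5.
have [c /(uniq_rcons ub) uc] : exists x, x \notin [:: j; j'; b] by exact: fresh5.
have [d /(uniq_rcons uc) ud] : exists x, x \notin [:: j; j'; b; c] by exact: fresh5.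
by exists b, c, d; apply/and3P.
Qed.

Lemma arr_ex2 j j' u : P j -> P j' -> j != j' -> ~~ P u -> exists v w, arr j j' u v w.
Proof.
move=> hj hj' h hu; have u0 : uniq [:: j; j'; u].
  by rewrite /= !inE negb_or h !pole_neq.
have [c /(uniq_rcons u0) uc] : exists x, x \notin [:: j; j'; u] by exact: fresh5.
have [d /(uniq_rcons uc) ud] : exists x, x \notin [:: j; j'; u; c] by exact: fresh5.
by exists c, d; apply/and3P.
Qed.

Lemma arr_ex3 j j' u v : P j -> P j' -> j != j' -> ~~ P u -> ~~ P v -> u != v ->
  exists w, arr j j' u v w.
Proof.
move=> hj hj' h hu hv huv; have u0 : uniq [:: j; j'; u; v].
  by rewrite /= !inE !negb_or h huv !pole_neq.
have [d /(uniq_rcons u0) ud] : exists x, x \notin [:: j; j'; u; v] by exact: fresh5.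
by exists d; apply/and3P.
Qed.

Lemma arr_mem j j' u v w x : arr j j' u v w -> x \in [:: j; j'; u; v; w].
Proof.
move=> h; apply/negPn/negP => /(uniq_rcons (arr_uniq h)) h'.
have := uniq_leq_size h' (s2 := enum 'I_5); rewrite size_enum_ord => /(_ _)/negP[] //.
by move=> y _; rewrite mem_enum.
Qed.

Lemma arr_third j j' u v w x : arr j j' u v w -> ~~ P x -> [|| x == u, x == v | x == w].
Proof.
move=> h hx; have [hj hj' _ _ _] := arr_P h; have := arr_mem x h.
by rewrite !inE (eq_sym x j) (eq_sym x j') (negbTE (pole_neq hj hx)) (negbTE (pole_neq hj' hx)).
Qed.

Lemma sum_arr (V : nmodType) (F : 'I_5 -> V) j j' u v w : arr j j' u v w ->
  \sum_(k | ~~ P k) F k = F u + F v + F w.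
Proof.
move=> h; have [hj hj' hu hv hw] := arr_P h.
rewrite (perm_big [:: j; j'; u; v; w]) /=.
  by rewrite !big_cons big_nil hj hj' hu hv hw /= addr0 addrA.
apply: uniq_perm; [exact: index_enum_uniq | exact: arr_uniq h |] => x.
by rewrite mem_index_enum (arr_mem x h).
Qed.

Lemma inS_old k : ~~ P k -> inS (old m k).
Proof. by move=> h; apply/existsP; exists k; rewrite h eqxx. Qed.

(** An edge of the old tetrahedron omitting [u] joins the two poles, two equatorial vertices, or a
    pole and an equatorial vertex; some arrangement puts it in one of the three forms. *)
Lemma tetedgeX_ind (Q : tetedge X -> Prop) :
  (forall t x, ~~ inS t -> Q (t, x)) ->
  (forall j j' u v w, arr j j' u v w ->
    [/\ Q (old m u, te u j j'), Q (old m u, te u v w) & Q (old m u, te u j v)]) ->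
  forall a, Q a.
Proof.
move=> h1 h2 [t x]; case: (boolP (inS t)); last exact: h1.
case/existsP => u /andP[hu /eqP->]; rewrite (te_lift u x).
have hab : lift u (val x).1 != lift u (val x).2.
  by rewrite (inj_eq (@lift_inj _ u)) neq_ltn (valP x).
move: (neq_lift u (val x).1) (neq_lift u (val x).2) hab.
move: (lift u (val x).1) (lift u (val x).2) => a b ha hb hab.
case: (boolP (P a)) => pa; case: (boolP (P b)) => pb.
- by have [v [w /h2[]]] := arr_ex2 pa pb hab hu.
- have [j' pj' hj'] := pole_other pa.
  by have [w /h2[]] := arr_ex3 pa pj' hj' hu pb hb.
- have [j' pj' hj'] := pole_other pb; rewrite teC.
  by have [w /h2[]] := arr_ex3 pb pj' hj' hu pa ha.
- have h : arr (p32 m) (q32 m) u a b.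
    by rewrite /arr P_p P_q uniq5E pq_neq ha hb hab !pole_neq ?P_p ?P_q.
  by case: (h2 _ _ _ _ _ h).
Qed.

(** A new tetrahedron has a single pole among its vertices, so each of its edges either contains
    that pole or is opposite to one that does. *)
Lemma tetedgeY_ind (Q : tetedge Y -> Prop) :
  (forall t x, ~~ inS t -> Q (keep m t, x)) ->
  (forall j j' u v w, arr j j' u v w ->
    Q (new m j, te j j' u) /\ Q (new m j, te j v w)) ->
  forall a, Q a.
Proof.
move=> h1 h2 [t' x]; case: (tet_cover m t') => [[j hj ->]|[t ht ->]]; last exact: h1.
rewrite (te_lift j x).
have hab : lift j (val x).1 != lift j (val x).2.
  by rewrite (inj_eq (@lift_inj _ j)) neq_ltn (valP x).
move: (neq_lift j (val x).1) (neq_lift j (val x).2) hab.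
move: (lift j (val x).1) (lift j (val x).2) => a b ha hb hab.
case: (boolP (P a)) => pa; case: (boolP (P b)) => pb.
- by case: (pole_cases hj pa ha pb) => E; [rewrite E eqxx in hb | rewrite E eqxx in hab].
- by have [v [w /h2[]]] := arr_ex2 hj pa ha pb.
- by rewrite teC; have [v [w /h2[]]] := arr_ex2 hj pb hb pa.
- have [j' pj' hj'] := pole_other hj.
  by have [w /arr_rot/arr_rot/h2[]] := arr_ex3 hj pj' hj' pa pb hab.
Qed.

Lemma te_pole k a b (T : Type) (f : 'I_5 -> 'I_5 -> T) :
  a != b -> k != a -> k != b -> (forall a b, f a b = f b a) ->
  f (lift k (val (te k a b)).1) (lift k (val (te k a b)).2) = f a b.
Proof. by move=> h1 h2 h3 h; case: (te_labels h1 h2 h3) => -[-> ->]. Qed.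

Variable R : realType.

(** A function on X is prescribed separately on the three kinds of edges of S. In the proof [f]
    reads the kind off the two ends and is symmetric in them, since the order of the ends in a
    [tedge] is not known. *)
Lemma buildX (K : tetedge X -> R) (Lpp Lee : 'I_5 -> R) (Lpe : 'I_5 -> 'I_5 -> 'I_5 -> R) :
  exists A : tetedge X -> R, (forall t x, ~~ inS t -> A (t, x) = K (t, x)) /\
    forall j j' u v w, arr j j' u v w ->
    [/\ A (old m u, te u j j') = Lpp u, A (old m u, te u v w) = Lee u &
        A (old m u, te u j v) = Lpe u j v].
Proof.
pose f k a b := if P a then if P b then Lpp k else Lpe k a b
                else if P b then Lpe k b a else Lee k.
exists (fun a => if [pick k | ~~ P k && (a.1 == old m k)] is Some k
  then f k (lift k (val a.2).1) (lift k (val a.2).2) else K a).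
split=> [t x ht|j j' u v w h] /=.
  by case: pickP => // k /andP[hk /eqP E]; move: ht; rewrite E inS_old.
have [hj hj' hu hv hw] := arr_P h.
have fC k a b : P a (+) P b || (P a && P b) || (~~ P a && ~~ P b) -> f k a b = f k b a.
  by rewrite /f; case: (P a); case: (P b).
have {}fC k a b : f k a b = f k b a by apply: fC; case: (P a); case: (P b).
have E a b : a != b -> u != a -> u != b ->
  (if [pick k | ~~ P k && (old m u == old m k)] is Some k
   then f k (lift k (val (te u a b)).1) (lift k (val (te u a b)).2)
   else K (old m u, te u a b)) = f u a b.
  move=> h1 h2 h3; case: pickP => [k /andP[hk /eqP E]|/(_ u)]; last by rewrite hu eqxx.
  by rewrite -(old_inj hu hk E) te_pole.
by move: (arr_neq h); do 9 (case/andP => ?); move=> ?; split; rewrite E /f ?hj ?hj' ?(negbTE hv) ?(negbTE hw) // eq_sym.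
Qed.

Lemma buildY (K : tetedge X -> R) (Lpe Lee : 'I_5 -> 'I_5 -> R) :
  exists A : tetedge Y -> R, (forall t x, ~~ inS t -> A (keep m t, x) = K (t, x)) /\
    forall j j' u v w, arr j j' u v w ->
    A (new m j, te j j' u) = Lpe j u /\ A (new m j, te j v w) = Lee j u.
Proof.
(* An equatorial edge is indexed by the third equatorial vertex; the sum singles it out, having that
   one term only. *)
pose f j a b := if P a then Lpe j b else if P b then Lpe j a
  else \sum_(u | ~~ P u && (u != a) && (u != b)) Lee j u.
exists (fun a => if [pick j | P j && (a.1 == new m j)] is Some j
  then f j (lift j (val a.2).1) (lift j (val a.2).2)
  else if [pick t | ~~ inS t && (a.1 == keep m t)] is Some t then K (t, a.2) else 0).
split=> [t x ht|j j' u v w h] /=.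
  case: pickP => [k /andP[hk /eqP]|_]; first by move/(keep_new ht hk).
  case: pickP => [t' /andP[ht' /eqP /(keep_inj ht ht') ->]|/(_ t)] //.
  by rewrite ht eqxx.
have [hj hj' hu hv hw] := arr_P h.
have new_inj' k k' : P k -> P k' -> new m k = new m k' -> k = k'.
  have := @new_inj _ _ _ m.
  by move=> N /orP[]/eqP-> /orP[]/eqP-> // E; case: N.
have E a b : a != b -> j != a -> j != b -> ~~ (P a && P b) ->
  (if [pick k | P k && (new m j == new m k)] is Some k
   then f k (lift k (val (te j a b)).1) (lift k (val (te j a b)).2)
   else if [pick t | ~~ inS t && (new m j == keep m t)] is Some t
        then K (t, te j a b) else 0) = f j a b.
  move=> h1 h2 h3 hab; case: pickP => [k /andP[hk /eqP E]|/(_ j)]; last by rewrite hj eqxx.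
  rewrite -(new_inj' _ _ hj hk E); have fC : f j a b = f j b a.
    rewrite /f; move: hab; case: (P a); case: (P b) => //= _.
    by apply: eq_bigl => l; rewrite andbAC.
  by case: (te_labels h1 h2 h3) => -[-> ->].
move: (arr_neq h); do 9 (case/andP => ?); move=> ?; split; rewrite E /f ?hj ?hj' ?(negbTE hu) ?(negbTE hv) ?(negbTE hw) //.
rewrite (eq_bigl (fun k => ~~ P k && ((k != v) && (k != w)))) => [|l]; last by rewrite andbA.
rewrite big_mkcondr (sum_arr _ h) !eqxx andbF ifT /= ?addr0 //.
by apply/andP.
Qed.

Lemma sumX (F : tetedge X -> R) j j' u v w : arr j j' u v w ->
  \sum_a F a = \sum_(t | ~~ inS t) \sum_x F (t, x) +
    (\sum_x F (old m u, x) + \sum_x F (old m v, x) + \sum_x F (old m w, x)).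
Proof.
move=> h; rewrite sum_tetedge (bigID inS) addrC /=; congr (_ + _).
rewrite -(sum_arr (fun k => \sum_x F (old m k, x)) h).
rewrite (eq_bigl (mem (old m @: [set k | ~~ P k]%SET))).
  rewrite big_imset /=; first by apply: eq_bigl => k; rewrite inE.
  by move=> k k'; rewrite !inE; apply: old_inj.
move=> t; apply/idP/imsetP.
  by case/existsP => k /andP[hk /eqP->]; exists k; rewrite ?inE.
by case=> k; rewrite inE => hk ->; exact: inS_old.
Qed.

Lemma sumY (F : tetedge Y -> R) j j' : P j -> P j' -> j != j' ->
  \sum_a F a = \sum_(t | ~~ inS t) \sum_x F (keep m t, x) +
    (\sum_x F (new m j, x) + \sum_x F (new m j', x)).
Proof.
move=> hj hj' hjj; rewrite sum_tetedge.
have nn : new m j' != new m j.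
  have := @new_inj _ _ _ m.
  by move: hj hj' hjj => /orP[]/eqP-> /orP[]/eqP->; rewrite ?eqxx // => _ /eqP //; rewrite eq_sym.
rewrite (bigD1 (new m j)) //= (bigD1 (new m j')) //= addrA addrC; congr (_ + _).
rewrite (eq_bigl (mem (keep m @: [set t | ~~ inS t]%SET))).
  rewrite big_imset /=; first by apply: eq_bigl => k; rewrite inE.
  by move=> k k'; rewrite !inE; apply: keep_inj.
move=> t'; apply/andP/imsetP => [[h1 h2]|[t]].
  case: (tet_cover m t') => [[k hk E]|[t ht ->]]; last by exists t; rewrite ?inE.
  by move: h1 h2; rewrite E; case: (pole_cases hj hj' hjj hk) => ->; rewrite eqxx.
by rewrite inE => ht ->; split; apply/eqP; apply: keep_new.
Qed.
End Bipyramid.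

(** Rewrites every edge with the poles first and the equatorial vertices in the order [u], [v], [w],
    so that equal terms become syntactically equal. *)
Ltac norm j j' u v w :=
  rewrite ?(teC _ j' j) ?(teC _ u j) ?(teC _ v j) ?(teC _ w j)
    ?(teC _ u j') ?(teC _ v j') ?(teC _ w j') ?(teC _ v u) ?(teC _ w u) ?(teC _ w v).

(** * The angle map of the move and its signs *)

Section Transport.
Variables (X Y : pseudo3) (e : edge X) (m : pachner32 Y e) (R : realType).

Notation P := (pole (p32 m) (q32 m)).
Notation inS := (in_S (p32 m) (q32 m) (old m)).

Lemma arr_det j j' u v w k v' w' : arr m j j' u v w -> arr m j k u v' w' ->
  k = j' /\ (v' = v /\ w' = w \/ v' = w /\ w' = v).
Proof.
move=> h h'; have [hj hj' hu hv hw] := arr_P h; have [_ hk _ hv' hw'] := arr_P h'.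
have E (x : 'I_5) : ~~ P x -> u != x -> x = v \/ x = w.
  move=> hx; rewrite eq_sym => ux; have := arr_third h hx; rewrite (negbTE ux) /=.
  by case/orP => /eqP ->; [left|right].
have /andP[jj _] := arr_neq h.
have /and5P[jk _ _ _ /andP[_ /and5P[_ _ uv uw vw]]] := arr_neq h'.
split; first by case: (pole_cases hj hj' jj hk) => // kj; rewrite kj eqxx in jk.
case: (E v') => // ev; case: (E w') => // ew; rewrite ev ew ?eqxx in vw *.
- by [].
- by left.
- by right.
- by [].
Qed.

(** Exchanging the poles and permuting the equatorial vertices is transitive on the twelve
    arrangements, so a property stable under the three generators passes from one arrangement to any
    other. *)
Lemma arr_conn (Q : 'I_5 -> 'I_5 -> 'I_5 -> 'I_5 -> 'I_5 -> Prop) :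
  (forall j j' u v w, arr m j j' u v w -> Q j j' u v w ->
    [/\ Q j' j u v w, Q j j' v w u & Q j j' u w v]) ->
  forall j j' u v w k k' x y z, arr m j j' u v w -> arr m k k' x y z ->
  Q j j' u v w -> Q k k' x y z.
Proof.
move=> hQ j j' u v w k k' x y z h h'; wlog ej : j j' h / j = k => [th q|].
  have [hj hj' _ _ _] := arr_P h; have [hk _ _ _ _] := arr_P h'.
  have jj : j != j' by case/andP: (arr_neq h).
  case: (pole_cases hj hj' jj hk) => E; first exact: (th j j').
  by apply: (th j' j) => //; [exact: arr_swap | case: (hQ _ _ _ _ _ h q)].
rewrite -ej in h' * => q; have [_ _ hu hv hw] := arr_P h; have [_ _ hx _ _] := arr_P h'.
have main a b c : arr m j j' a b c -> Q j j' a b c -> x = a -> Q j k' x y z.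
  move=> ha qa E; rewrite E in h' *.
  have [-> [[-> ->]|[-> ->]]] := arr_det ha h'; first by [].
  by case: (hQ _ _ _ _ _ ha qa).
have [_ q2 _] := hQ _ _ _ _ _ h q.
have [_ q3 _] := hQ _ _ _ _ _ (arr_rot h) q2.
case/or3P: (arr_third h hx) => /eqP E; first exact: (main u v w).
  by apply: (main v w u) => //; exact: arr_rot.
by apply: (main w u v) => //; do 2 apply: arr_rot.
Qed.

Notation fun5 T := ('I_5 -> 'I_5 -> 'I_5 -> 'I_5 -> 'I_5 -> T).

(** The vertex [u] determines the arrangement up to exchanging the poles and exchanging [v] and [w],
    whence the invariance required of [Fpp] and [Fee]. The triple [u], [j], [v] determines it
    completely, so [Fpe] is arbitrary. *)
Lemma build_old (K : tetedge X -> R) (Fpp Fee Fpe : fun5 R) :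
  (forall j j' u v w, arr m j j' u v w ->
    [/\ Fpp j' j u v w = Fpp j j' u v w, Fpp j j' u w v = Fpp j j' u v w,
        Fee j' j u v w = Fee j j' u v w & Fee j j' u w v = Fee j j' u v w]) ->
  exists A : tetedge X -> R, (forall t x, ~~ inS t -> A (t, x) = K (t, x)) /\
    forall j j' u v w, arr m j j' u v w ->
    [/\ A (old m u, te u j j') = Fpp j j' u v w,
        A (old m u, te u v w) = Fee j j' u v w &
        A (old m u, te u j v) = Fpe j j' u v w].
Proof.
move=> hF.
pose ch (F : fun5 R) u := if [pick z : 'I_5 * 'I_5 * 'I_5 * 'I_5 |
  arr m z.1.1.1 z.1.1.2 u z.1.2 z.2] is Some z then F z.1.1.1 z.1.1.2 u z.1.2 z.2 else 0.
pose ch' u j v := if [pick z : 'I_5 * 'I_5 | arr m j z.1 u v z.2] is Some z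
  then Fpe j z.1 u v z.2 else 0.
have chE F : (forall j j' u v w, arr m j j' u v w -> F j' j u v w = F j j' u v w /\
    F j j' u w v = F j j' u v w) ->
  forall j j' u v w, arr m j j' u v w -> ch F u = F j j' u v w.
  move=> hs j j' u v w h; rewrite /ch; case: pickP => [[[[k k'] y] z] /= h'|/(_ (j, j', v, w))]; last by rewrite h.
  have [hj hj' _ _ _] := arr_P h; have [hk _ _ _ _] := arr_P h'.
  have jj : j != j' by case/andP: (arr_neq h).
  case: (pole_cases hj hj' jj hk) => E; subst k.
    have [-> [[-> ->]|[-> ->]]] := arr_det h h'; first by [].
    by case: (hs _ _ _ _ _ h).
  have [-> [[-> ->]|[-> ->]]] := arr_det (arr_swap h) h'; first by case: (hs _ _ _ _ _ h).
  by case: (hs _ _ _ _ _ h) => <- _; case: (hs _ _ _ _ _ (arr_swap h)).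
have [A [A1 A2]] := buildX m K (ch Fpp) (ch Fee) ch'.
exists A; split=> // j j' u v w h; case: (A2 _ _ _ _ _ h) => -> -> ->; split.
- by apply: chE => // ? ? ? ? ? /hF[].
- by apply: chE => // ? ? ? ? ? /hF[].
- rewrite /ch'; case: pickP => [[k z] /= h'|/(_ (j', w))]; last by rewrite h.
  have [-> [[_ ->]|[ev ez]]] := arr_det h h'; first by [].
  by have := arr_neq h; rewrite -ev eqxx !andbF.
Qed.

Lemma build_new (K : tetedge X -> R) (Fpe Fee : fun5 R) :
  (forall j j' u v w, arr m j j' u v w ->
    Fpe j j' u w v = Fpe j j' u v w /\ Fee j j' u w v = Fee j j' u v w) ->
  exists B : tetedge Y -> R, (forall t x, ~~ inS t -> B (keep m t, x) = K (t, x)) /\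
    forall j j' u v w, arr m j j' u v w ->
    B (new m j, te j j' u) = Fpe j j' u v w /\ B (new m j, te j v w) = Fee j j' u v w.
Proof.
move=> hF.
pose ch (F : fun5 R) j u := if [pick z : 'I_5 * 'I_5 * 'I_5 |
  arr m j z.1.1 u z.1.2 z.2] is Some z then F j z.1.1 u z.1.2 z.2 else 0.
have chE F : (forall j j' u v w, arr m j j' u v w -> F j j' u w v = F j j' u v w) ->
  forall j j' u v w, arr m j j' u v w -> ch F j u = F j j' u v w.
  move=> hs j j' u v w h; rewrite /ch; case: pickP => [[[k y] z] /= h'|/(_ (j', v, w))]; last by rewrite h.
  have [-> [[-> ->]|[-> ->]]] := arr_det h h'; first by [].
  exact: hs h.
have [A [A1 A2]] := buildY m K (ch Fpe) (ch Fee).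
exists A; split=> // j j' u v w h; case: (A2 _ _ _ _ _ h) => -> ->.
by split; apply: chE => // ? ? ? ? ? /hF[].
Qed.

(** The orientation of S_e relative to the order of the five labels; by [sg_old], S carries the
    opposite one. *)
Definition sgnS : R := (-1) ^+ (~~ sgn (new m (p32 m))) * (-1) ^+ odd (p32 m).

Lemma sg_new j : P j -> sg R (new m j) * (-1) ^+ odd j = sgnS.
Proof.
have [s [_ h]] := sgn_S m; rewrite /sg /sgnS => hj; rewrite !h ?P_p //.
by case: (s); case: (odd j); case: (odd (p32 m)) => /=; rewrite !(expr0, expr1); ring.
Qed.

Lemma sg_old u : ~~ P u -> sg R (old m u) * (-1) ^+ odd u = - sgnS.
Proof.
have [s [h' h]] := sgn_S m; rewrite /sg /sgnS => hj; rewrite h' // h ?P_p //.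
by case: (s); case: (odd u); case: (odd (p32 m)) => /=; rewrite !(expr0, expr1); ring.
Qed.

(** The orientation seen from an arrangement: it alternates in the poles and in the equatorial
    vertices. *)
Definition arr_sign j j' u v w : R := sgnS * (sgn5 j j' u v w)%:~R.

Lemma arr_sign_swap j j' u v w : arr_sign j' j u v w = - arr_sign j j' u v w.
Proof. by rewrite /arr_sign /sgn5 (cmpC j' j) !(rmorphM, rmorphN) /=; ring. Qed.

Lemma arr_sign_flip j j' u v w : arr_sign j j' u w v = - arr_sign j j' u v w.
Proof. by rewrite /arr_sign /sgn5 (cmpC w v) !(rmorphM, rmorphN) /=; ring. Qed.

Lemma arr_sign_rot j j' u v w : arr_sign j j' v w u = arr_sign j j' u v w.
Proof. by rewrite /arr_sign /sgn5 (cmpC v u) (cmpC w u) !(rmorphM, rmorphN) /=; ring. Qed.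

Lemma arr_sign_sqr j j' u v w : arr m j j' u v w -> arr_sign j j' u v w * arr_sign j j' u v w = 1.
Proof.
move=> h; have -> : arr_sign j j' u v w * arr_sign j j' u v w =
   sgnS * sgnS * (sgn5 j j' u v w * sgn5 j j' u v w)%:~R.
  by rewrite /arr_sign intrM; ring.
have -> : sgnS * sgnS = 1.
  by rewrite /sgnS; case: (sgn _); case: (odd _); rewrite /= !(expr0, expr1); ring.
suff -> : sgn5 j j' u v w * sgn5 j j' u v w = 1 by rewrite mulr1.
have E (a b : 'I_5) : a != b -> cmp a b * cmp a b = 1 by move=> ab; exact: cmp_sqr.
have := arr_neq h; do 9 (case/andP => /E ?); move=> /E ?.
rewrite /sgn5; set s := (X in X = 1).
have -> : s = (cmp j j' * cmp j j') * (cmp j u * cmp j u) * (cmp j v * cmp j v)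
  * (cmp j w * cmp j w) * (cmp j' u * cmp j' u) * (cmp j' v * cmp j' v)
  * (cmp j' w * cmp j' w) * (cmp u v * cmp u v) * (cmp u w * cmp u w) * (cmp v w * cmp v w).
  by rewrite /s; ring.
by do 10 (match goal with H : ?x * ?x = 1 |- context [?x * ?x] => rewrite H; clear H end).
Qed.

Lemma J_old_pp (G : tetedge X -> R) j j' u v w : arr m j j' u v w ->
  J G (old m u, te u j j') = - arr_sign j j' u v w *
   (G (old m u, te u j v) + G (old m u, te u j' w) - G (old m u, te u j w) - G (old m u, te u j' v)).
Proof.
move=> h; have [_ _ hu _ _] := arr_P h.
have h1 : uniq [:: u; j; j'; v; w] by have h1 := arr_uniq h; uniq5 h1.
rewrite (J_label _ _ h1) (sg_old hu) /arr_sign /sgn5 (cmpC u j) (cmpC u j').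
by rewrite !(rmorphM, rmorphN) /=; ring.
Qed.

Lemma J_old_pe (G : tetedge X -> R) j j' u v w : arr m j j' u v w ->
  J G (old m u, te u j v) = arr_sign j j' u v w *
   (G (old m u, te u j j') + G (old m u, te u v w) - G (old m u, te u j w) - G (old m u, te u j' v)).
Proof.
move=> h; have [_ _ hu _ _] := arr_P h.
have h1 : uniq [:: u; j; v; j'; w] by have h1 := arr_uniq h; uniq5 h1.
rewrite (J_label _ _ h1) (sg_old hu) /arr_sign /sgn5 (cmpC u j) (cmpC u j') (cmpC v j') (teC _ v j').
by rewrite !(rmorphM, rmorphN) /=; ring.
Qed.

Lemma J_old_ee (G : tetedge X -> R) j j' u v w : arr m j j' u v w ->
  J G (old m u, te u v w) = J G (old m u, te u j j').
Proof.
by move=> h; apply/esym/J_opp; have h1 := arr_uniq h; uniq5 h1.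
Qed.

Lemma J_new (G : tetedge Y -> R) j j' u v w : arr m j j' u v w ->
  J G (new m j, te j j' u) = arr_sign j j' u v w *
   (G (new m j, te j j' v) + G (new m j, te j u w) - G (new m j, te j j' w) - G (new m j, te j u v)).
Proof.
move=> h; have [hj _ _ _ _] := arr_P h.
by rewrite (J_label _ _ (arr_uniq h)) (sg_new hj).
Qed.

Lemma J_new_ee (G : tetedge Y -> R) j j' u v w : arr m j j' u v w ->
  J G (new m j, te j v w) = J G (new m j, te j j' u).
Proof. by move=> h; apply/esym/J_opp; have h1 := arr_uniq h; uniq5 h1. Qed.

Lemma J_keep (G : tetedge X -> R) (G' : tetedge Y -> R) t x : ~~ inS t ->
  (forall y, G' (keep m t, y) = G (t, y)) -> J G' (keep m t, x) = J G (t, x).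
Proof.
move=> ht h; rewrite !J_local /sg sgn_keep //; congr (_ * _).
by apply: eq_bigr => y _; rewrite h.
Qed.

(** The formulas of the move are imposed on arbitrary functions instead of shapes, which makes P a
    linear map on the whole coordinate space, applicable to tangent vectors as well. *)
Definition pachner_rel (A : tetedge X -> R) (B : tetedge Y -> R) : Prop :=
  (forall t x, ~~ inS t -> B (keep m t, x) = A (t, x)) /\
  forall j j' u v w, arr m j j' u v w ->
    B (new m j, te j j' u) = A (old m v, te v j' u) + A (old m w, te w j' u) /\
    B (new m j, te j v w) = A (old m v, te v j' u) + A (old m w, te w j' u).

Lemma pachner_rel_ex A : exists B, pachner_rel A B.
Proof.
apply: build_new => j j' u v w h; by rewrite addrC.
Qed.

Definition pachner_map A : tetedge Y -> R := sval (cid (pachner_rel_ex A)).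

Lemma pachner_mapP A : pachner_rel A (pachner_map A).
Proof. exact: (svalP (cid (pachner_rel_ex A))). Qed.

Lemma pachner_rel_uniq A B b : pachner_rel A B -> B b = pachner_map A b.
Proof.
move=> [h1 h2]; have [h3 h4] := pachner_mapP A; move: b; apply: (tetedgeY_ind (m := m)) => [t x ht|j j' u v w h] /=.
  by rewrite h1 // h3.
by have [-> ->] := h2 _ _ _ _ _ h; have [-> ->] := h4 _ _ _ _ _ h.
Qed.

Lemma pachner_map_lin c A A' b : pachner_map (fun a => c * A a + A' a) b = c * pachner_map A b + pachner_map A' b.
Proof.
apply/esym/(pachner_rel_uniq (B := fun b => c * pachner_map A b + pachner_map A' b)).
have [h1 h2] := pachner_mapP A; have [h3 h4] := pachner_mapP A'.
split=> [t x ht|j j' u v w h]; first by rewrite h1 // h3.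
by have [-> ->] := h2 _ _ _ _ _ h; have [-> ->] := h4 _ _ _ _ _ h; split; ring.
Qed.

Definition compat (G : tetedge X -> R) (G' : tetedge Y -> R) : Prop :=
  (forall t x, ~~ inS t -> G' (keep m t, x) = G (t, x)) /\
  forall j j' u v w, arr m j j' u v w ->
    G' (new m j, te j j' v) = G (old m u, te u j' v) /\
    G' (new m j, te j v w) = G (old m u, te u v w).

(** [compat] does not involve e; its value, as seen from the three old tetrahedra, is recorded
    here. *)
Definition inner_const (G : tetedge X -> R) (c : R) : Prop :=
  forall j j' u v w, arr m j j' u v w -> G (old m u, te u j j') = c.

(** Each new component of P adds two rows of [J G], taken at [j'u] in the tetrahedra omitting [v]
    and [w]. They have opposite signs, so the value [c] at e and the value at the edge [ju], present
    in both, cancel; what remains is the row of [J G']. *)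
Lemma compat_J G G' c : compat G G' -> inner_const G c -> pachner_rel (J G) (J G').
Proof.
move=> [h1 h2] hc; split=> [t x ht|j j' u v w h]; first by apply: J_keep => // y; exact: h1.
have h3 : arr m j' j v u w by do 2 apply: arr_rot; apply/arr_flip/arr_swap.
have h4 : arr m j' j w u v by do 2 apply: arr_rot; apply: arr_swap.
rewrite (J_new_ee _ h) (J_new _ h) (J_old_pe _ h3) (J_old_pe _ h4).
rewrite !(hc _ _ _ _ _ h3) !(hc _ _ _ _ _ h4).
have -> : arr_sign j' j v u w = arr_sign j j' u v w by rewrite -(arr_sign_rot j' j) arr_sign_flip arr_sign_swap arr_sign_rot opprK.
have -> : arr_sign j' j w u v = - arr_sign j j' u v w by rewrite -(arr_sign_rot j' j) arr_sign_swap.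
have [_ <-] := h2 _ _ _ _ _ (arr_swap h3); have [_ <-] := h2 _ _ _ _ _ (arr_swap h4).
have [<- _] := h2 _ _ _ _ _ (arr_flip (arr_swap h3)); have [<- _] := h2 _ _ _ _ _ (arr_flip (arr_swap h4)).
have [<- _] := h2 _ _ _ _ _ h3; have [<- _] := h2 _ _ _ _ _ h4.
by split; ring.
Qed.
End Transport.

(** * Transport of gauge functions and angles *)

Lemma lift_ex (n : nat) (k a : 'I_n) : a != k -> exists i, lift k i = a.
Proof. by rewrite eq_sym => /unlift_some[i h _]; exists i. Qed.

Section Gauge_transport.
Variables (X Y : pseudo3) (e : edge X) (m : pachner32 Y e) (R : realType).

Notation P := (pole (p32 m) (q32 m)).
Notation inS := (in_S (p32 m) (q32 m) (old m)).
Notation fc := (face_corr (p32 m) (q32 m) (old m) (new m) (keep m)).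

Lemma face_edge_label (Z : pseudo3) (t : tet Z) k i z1 z2 :
  face_edge (t, i) z1 z2 = (t, te k (lift k (lift i z1)) (lift k (lift i z2))).
Proof. by rewrite /face_edge /te /= !bumpK. Qed.

Lemma lift2_neq (j k : 'I_5) (i i' : 'I_4) (z1 z2 : 'I_3) :
  lift k i = j -> lift j i' = k -> z1 != z2 ->
  let a := lift k (lift i z1) in let b := lift k (lift i z2) in
  [&& a != b, a != j, a != k, b != j & b != k].
Proof.
move=> h1 h2 hz /=; rewrite !(eq_sym _ k) !neq_lift !(inj_eq lift_inj) hz !andbT /=.
by rewrite (lift_lift z1 h1 h2) (lift_lift z2 h1 h2) !(eq_sym _ j) !neq_lift.
Qed.

Lemma glue_poles j j' i i' : P j -> P j' -> lift j i = j' -> lift j' i' = j ->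
  glue (new m j, i) = Some (new m j', i').
Proof.
move=> /orP[]/eqP-> /orP[]/eqP-> h1 h2; try exact: glue_new.
- by move: (neq_lift (p32 m) i); rewrite h1 eqxx.
- by apply: glue_sym; apply: glue_new.
- by move: (neq_lift (q32 m) i); rewrite h1 eqxx.
Qed.

Lemma compat_face (G : tetedge X -> R) (G' : tetedge Y -> R) f f' z1 z2 :
  compat m G G' -> fc f f' -> z1 != z2 -> G' (face_edge f' z1 z2) = G (face_edge f z1 z2).
Proof.
move=> [c1 c2] [[hf ->]|[k [j [hk hj [e1 e1'] [e2 e2']]]]] hz; first exact: c1.
case: f f' e1 e1' e2 e2' => [t i] [t' i'] /= -> -> h1 h2.
rewrite (face_edge_label _ j) (face_edge_label _ k) -!(lift_lift _ h1 h2).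
have /and5P[] := lift2_neq h1 h2 hz; move: (lift k (lift i z1)) (lift k (lift i z2)).
move=> a b ab aj ak bj bk; rewrite eq_sym in aj; rewrite eq_sym in bj.
rewrite eq_sym in ak; rewrite eq_sym in bk.
case: (boolP (P a)) => pa; case: (boolP (P b)) => pb.
- by case: (pole_cases hj pa aj pb) => E; rewrite E eqxx in ab bj.
- by have [w /c2[]] := arr_ex3 hj pa aj hk pb bk.
- by have [w /c2[]] := arr_ex3 hj pb bj hk pa ak; rewrite !(teC _ _ b).
- have [j' hj' jj] := pole_other hj.
  by apply: (proj2 (c2 j j' k a b _)); rewrite /arr hj hj' uniq5E jj ab ak bk !(@pole_neq _ _ _ m).
Qed.

(** Faces not interior to S_e correspond to faces of X with matching gluings. The face shared by the
    two new tetrahedra has equatorial edges only, and from either side the value at [vw] is that of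
    [G] in [old m u]. *)
Lemma compat_isgauge_new (G : tetedge X -> R) (G' : tetedge Y -> R) :
  compat m G G' -> isgauge G -> isgauge G'.
Proof.
move=> c hG [t' i'] z1 z2 hz.
have main f : fc f (t', i') -> G' (face_edge (t', i') z1 z2) =
    if glue (t', i') is Some f' then G' (face_edge f' z1 z2) else 0.
  move=> hf; rewrite (compat_face c hf hz) hG //.
  have := glue_outer hf; case: (glue f) => [h [h' hh ->]|-> //].
  by rewrite (compat_face c hh hz).
case: (tet_cover m t') => [[j hj E]|[t ht E]]; last first.
  by apply: (main (t, i')); left; rewrite E.
subst t'; case: (boolP (P (lift j i'))) => hk; last first.
  have [i2 hi2] := lift_ex (neq_lift j i').
  by apply: (main (old m (lift j i'), i2)); right; exists (lift j i'), j.
have [i hi] := lift_ex (neq_lift j i').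
rewrite (glue_poles hj hk erefl hi).
rewrite (face_edge_label _ j) (face_edge_label _ (lift j i')) -!(lift_lift _ hi erefl).
have /and5P[] := lift2_neq erefl hi hz.
rewrite !(lift_lift _ erefl hi).
move: (lift _ (lift i z1)) (lift _ (lift i z2)) (neq_lift j i').
move=> a b jk ab ak aj bk bj; rewrite eq_sym in aj; rewrite eq_sym in bj.
rewrite eq_sym in ak; rewrite eq_sym in bk.
have pa : ~~ P a by apply/negP => /(pole_cases hj hk jk)[] E; rewrite E eqxx in ak aj.
have pb : ~~ P b by apply/negP => /(pole_cases hj hk jk)[] E; rewrite E eqxx in bk bj.
have [w /arr_rot/arr_rot h] := arr_ex3 hj hk jk pa pb ab.
have [_ c2] := c.
by have [_ ->] := c2 _ _ _ _ _ h; have [_ ->] := c2 _ _ _ _ _ (arr_swap h).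
Qed.

(** On an interior face of S the edge e is settled by [inner_const]. The other two edges join a pole
    to the remaining equatorial vertex; both sides are compared with the same value of [G']. *)
Lemma compat_isgauge_old (G : tetedge X -> R) (G' : tetedge Y -> R) g :
  compat m G G' -> inner_const m G g -> isgauge G' -> isgauge G.
Proof.
move=> c hg hG [t i] z1 z2 hz.
have main f' : fc (t, i) f' -> G (face_edge (t, i) z1 z2) =
    if glue (t, i) is Some f' then G (face_edge f' z1 z2) else 0.
  move=> hf; rewrite -(compat_face c hf hz) hG //.
  have := glue_outer hf; case: (glue (t, i)) => [h [h' hh ->]|-> //].
  by rewrite (compat_face c hh hz).
case: (boolP (inS t)) => ht; last by apply: (main (keep m t, i)); left.
case/existsP: ht => k /andP[hk /eqP E]; subst t.
have [i' hi'] := lift_ex (neq_lift k i).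
case: (boolP (P (lift k i))) => hj.
  by apply: (main (new m (lift k i), i')); right; exists k, (lift k i).
have -> : glue (old m k, i) = Some (old m (lift k i), i') by apply: glue_old.
rewrite (face_edge_label _ k) (face_edge_label _ (lift k i)) -!(lift_lift _ erefl hi').
have /and5P[] := lift2_neq erefl hi' hz.
move: (lift k (lift i z1)) (lift k (lift i z2)) (neq_lift k i) hj; move: (lift k i) => l.
move=> a b kl hl ab al ak bl bk; rewrite eq_sym in al; rewrite eq_sym in bl.
rewrite eq_sym in ak; rewrite eq_sym in bk; have [_ c2] := c.
have one x y : P x -> ~~ P y -> k != y -> l != y ->
    G (old m k, te k x y) = G (old m l, te l x y).
  move=> px py ky ly; have [j hj xj] := pole_other px; rewrite eq_sym in xj.
  have h : arr m j x k y l.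
    by rewrite /arr hj px uniq5E xj ky kl (eq_sym y l) ly !(@pole_neq _ _ _ m).
  have [<- _] := c2 _ _ _ _ _ h.
  by have [<- _] := c2 _ _ _ _ _ (arr_flip (arr_rot (arr_rot h))).
case: (boolP (P a)) => pa; case: (boolP (P b)) => pb.
- have [w h] := arr_ex3 pa pb ab hk hl kl.
  by rewrite (hg _ _ _ _ _ h) (hg _ _ _ _ _ (arr_rot h)).
- exact: one.
- by rewrite !(teC _ a); exact: one.
- have h : arr m (p32 m) (q32 m) k l a.
    by rewrite /arr P_p P_q uniq5E pq_neq kl ak al !(@pole_neq _ _ _ m) ?P_p ?P_q.
  by have := arr_third h pb; rewrite !(eq_sym b) (negbTE bk) (negbTE bl) (negbTE ab).
Qed.

(** An edge joining a pole to an equatorial vertex lies in two old tetrahedra and one new one. The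
    two old ones are glued along a face through this edge, so the value to be given to [G'] is
    unambiguous. *)
Lemma compat_ex_new (G : tetedge X -> R) : isgauge G ->
  exists2 G', compat m G G' & isgauge G'.
Proof.
move=> hG.
have Gc j j' u v w : arr m j j' u v w -> G (old m u, te u j' v) = G (old m w, te w j' v).
  move=> h; have [hj hj' hu hv hw] := arr_P h.
  have /and5P[jj ju jv jw /and5P[j'u j'v j'w uv /andP[uw vw]]] := arr_neq h.
  have [i' hi'] := lift_ex uw; have wu := uw; rewrite eq_sym in wu.
  have [i hi] := lift_ex wu.
  have gl := glue_old hw hu hi hi'.
  have hj2 : lift u i != j' by rewrite hi eq_sym.
  have lu a : u != a -> w != a -> exists z, lift u (lift i z) = a.
    rewrite eq_sym => /lift_ex[a' <-]; rewrite -hi (inj_eq lift_inj) eq_sym.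
    by move=> /lift_ex[z <-]; exists z.
  have [z1 e1] : exists z, lift u (lift i z) = j' by apply: lu; rewrite eq_sym.
  have [z2 e2] : exists z, lift u (lift i z) = v by apply: lu => //; rewrite eq_sym.
  have hz : z1 != z2 by apply: contraNneq j'v => hz; rewrite -e1 -e2 hz.
  have := hG (old m u, i) z1 z2 hz; rewrite gl (face_edge_label _ u) (face_edge_label _ w).
  by rewrite -!(lift_lift _ hi hi') e1 e2 => ->.
have [j j' u v w h|G' [h1 h2]] := build_new (m := m) G
  (Fpe := fun j j' u v w => G (old m v, te v j' u)) (Fee := fun j j' u v w => G (old m u, te u v w)).
  split; last by rewrite teC.
  by apply/esym; apply: (Gc j); apply/arr_flip/arr_rot.
have c : compat m G G'.
  split=> // j j' u v w h; split; last by case: (h2 _ _ _ _ _ h).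
  by case: (h2 _ _ _ _ _ (arr_flip (arr_rot h))) => + _.
by exists G' => //; apply: compat_isgauge_new hG.
Qed.

(** The value [g] at e is free, as e is the only edge of S missing in S_e. An equatorial edge lies
    in both new tetrahedra, which are glued along a face through it, so the value to be given to [G]
    is unambiguous. *)
Lemma compat_ex_old (G' : tetedge Y -> R) g : isgauge G' ->
  exists2 G, compat m G G' & isgauge G /\ inner_const m G g.
Proof.
move=> hG.
have Gc j j' u v w : arr m j j' u v w -> G' (new m j, te j v w) = G' (new m j', te j' v w).
  move=> h; have [hj hj' hu hv hw] := arr_P h.
  have /and5P[jj ju jv jw /and5P[j'u j'v j'w uv /andP[uw vw]]] := arr_neq h.
  have [i' hi'] := lift_ex jj; have j'j := jj; rewrite eq_sym in j'j.
  have [i hi] := lift_ex j'j.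
  have gl := glue_poles hj hj' hi hi'.
  have lu a : j != a -> j' != a -> exists z, lift j (lift i z) = a.
    rewrite eq_sym => /lift_ex[a' <-]; rewrite -{1}hi (inj_eq lift_inj) eq_sym.
    by move=> /lift_ex[z <-]; exists z.
  have [z1 e1] := lu v jv j'v; have [z2 e2] := lu w jw j'w.
  have hz : z1 != z2 by apply: contraNneq vw => hz; rewrite -e1 -e2 hz.
  have := hG (new m j, i) z1 z2 hz; rewrite gl (face_edge_label _ j) (face_edge_label _ j').
  by rewrite -!(lift_lift _ hi hi') e1 e2.
have [j j' u v w h|G [h1 h2]] := build_old (m := m) (fun a => G' (keep m a.1, a.2))
  (Fpp := fun _ _ _ _ _ => g) (Fee := fun j j' u v w => G' (new m j, te j v w))
  (fun j j' u v w => G' (new m j', te j' j v)).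
  by split=> //; [rewrite -(Gc _ _ _ _ _ h) | rewrite teC].
have c : compat m G G'.
  split=> [t x ht|j j' u v w h]; first by rewrite h1.
  have [_ <- _] := h2 _ _ _ _ _ h.
  by have [_ _ <-] := h2 _ _ _ _ _ (arr_swap h).
have hg : inner_const m G g by move=> j j' u v w h; have [-> _ _] := h2 _ _ _ _ _ h.
by exists G => //; split=> //; exact: compat_isgauge_old c hg hG.
Qed.

Lemma sum_old (F : tedge -> R) j j' u v w : arr m j j' u v w ->
  \sum_x F x = F (te u j j') + F (te u v w) + F (te u j v) + F (te u j' w)
    + F (te u j w) + F (te u j' v).
Proof. by move=> h; apply: sum_label; have h1 := arr_uniq h; uniq5 h1. Qed.

(** * The gauge function of e *)

Lemma chi_ex : exists2 chi : tetedge X -> R, compat m chi (fun=> 0) &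
  isgauge chi /\ inner_const m chi 1.
Proof. by apply: compat_ex_old; exact: isgauge0. Qed.

(** The indicator of e, built by extending the zero gauge function of Y by the value 1 at e, so that
    its gauge property comes with the construction. *)
Definition chi : tetedge X -> R := sval (cid2 chi_ex).

Lemma chi_compat : compat m chi (fun=> 0).
Proof. exact: (s2valP (cid2 chi_ex)). Qed.

Lemma chi_gauge : isgauge chi.
Proof. by case: (s2valP' (cid2 chi_ex)). Qed.

Lemma chi_inner : inner_const m chi 1.
Proof. by case: (s2valP' (cid2 chi_ex)). Qed.

Lemma chiE j j' u v w : arr m j j' u v w ->
  [/\ chi (old m u, te u j j') = 1, chi (old m u, te u v w) = 0 &
      chi (old m u, te u j v) = 0].
Proof.
move=> h; have [_ c] := chi_compat; rewrite (chi_inner h).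
by have [_ <-] := c _ _ _ _ _ h; have [<- _] := c _ _ _ _ _ (arr_swap h).
Qed.

Lemma chi_keep t x : ~~ inS t -> chi (t, x) = 0.
Proof. by move=> ht; have [h _] := chi_compat; rewrite -h. Qed.

Lemma phi_pq u : ~~ P u -> phi (old m u, te u (p32 m) (q32 m)) = e.
Proof.
move=> hu; have up : u != p32 m by rewrite eq_sym (@pole_neq _ _ _ m) ?P_p.
have uq : u != q32 m by rewrite eq_sym (@pole_neq _ _ _ m) ?P_q.
have E := te_labels (pq_neq m) up uq.
case: E => -[h1 h2]; first exact: edge_S.
have := valP (te u (p32 m) (q32 m)); rewrite -(lift_lt u) h1 h2.
by rewrite ltnNge (ltnW (pole_lt m)).
Qed.

(** A gauge function factors through the edges of X and [chi] is 1 at e, so a pair where it vanishes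
    cannot lie above e. Only the three edges joining the poles in the old tetrahedra are left. *)
Lemma chi_phi a : chi a = (phi a == e)%:R.
Proof.
have [g _ hg] := isgauge_edge chi_gauge.
have ge : g e = 1.
  have [u [v [w h]]] := arr_ex1 (P_p m) (P_q m) (pq_neq m).
  have [_ _ hu _ _] := arr_P h; rewrite -(phi_pq hu) -hg; exact: chi_inner h.
have zero b : chi b = 0 -> chi b = (phi b == e)%:R.
  move=> hb; case: eqP => // E; by move: hb; rewrite hg E ge.
move: a; apply: (tetedgeX_ind (m := m)) => [t x ht|j j' u v w h]; first exact/zero/chi_keep.
have [h1 h2 h3] := chiE h; split; [|exact: zero|exact: zero].
have [hj hj' hu _ _] := arr_P h; have /andP[jj _] := arr_neq h.
rewrite h1; have pqE := phi_pq hu.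
case: (pole_cases hj hj' jj (P_p m)) => Ep; case: (pole_cases hj hj' jj (P_q m)) => Eq.
- by have := pq_neq m; rewrite Ep Eq eqxx.
- by rewrite -Ep -Eq pqE eqxx.
- by rewrite -Ep -Eq teC pqE eqxx.
- by have := pq_neq m; rewrite Ep Eq eqxx.
Qed.

Lemma sum_chi (A : tetedge X -> R) : \sum_a chi a * A a = \sum_(a | phi a == e) A a.
Proof.
rewrite [RHS]big_mkcond; apply: eq_bigr => a _; rewrite chi_phi.
by case: eqP; rewrite ?mul1r ?mul0r.
Qed.

Lemma sum_chi_arr (A : tetedge X -> R) j j' u v w : arr m j j' u v w ->
  \sum_a chi a * A a =
    A (old m u, te u j j') + A (old m v, te v j j') + A (old m w, te w j j').
Proof.
move=> h; have hv := arr_rot h; have hw := arr_rot hv.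
rewrite (sumX _ h) big1 ?add0r => [|t ht]; last first.
  by apply: big1 => x _; rewrite chi_keep // mul0r.
have one a b c : arr m j j' a b c ->
    \sum_x chi (old m a, x) * A (old m a, x) = A (old m a, te a j j').
  move=> ha; rewrite (sum_old _ ha).
  have [-> -> ->] := chiE ha; have [_ _ ->] := chiE (arr_swap ha).
  have [_ _ ->] := chiE (arr_flip ha); have [_ _ ->] := chiE (arr_flip (arr_swap ha)).
  ring.
by rewrite (one _ _ _ h) (one _ _ _ hv) (one _ _ _ hw).
Qed.

(** * Vertex sums and the kernel of the angle map *)

Lemma vsum_te (Z : pseudo3) (A : tetedge Z -> R) t c (k a b x d : 'I_5) :
  (forall v, vsum A t v = c) -> uniq [:: k; a; b; x; d] ->
  A (t, te k a b) + A (t, te k a x) + A (t, te k a d) = c.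
Proof.
move=> hA h; have ka : a != k by move: h; rewrite uniq5E eq_sym => /andP[].
have [v hv] := lift_ex ka.
by rewrite -(vsum_label _ _ h hv) hA.
Qed.

(** The sums at [a] and [b] minus those at [x] and [d] give twice the difference of the two opposite
    values. *)
Lemma vsum_opp (Z : pseudo3) (A : tetedge Z -> R) t c (k a b x d : 'I_5) :
  (forall v, vsum A t v = c) -> uniq [:: k; a; b; x; d] ->
  A (t, te k a b) = A (t, te k x d).
Proof.
move=> hA h.
have h2 : uniq [:: k; b; a; x; d] by uniq5 h.
have h3 : uniq [:: k; x; d; a; b] by uniq5 h.
have h4 : uniq [:: k; d; x; a; b] by uniq5 h.
have := vsum_te hA h; have := vsum_te hA h2; have := vsum_te hA h3; have := vsum_te hA h4.
rewrite (teC _ b a) (teC _ x a) (teC _ x b) (teC _ d x) (teC _ d a) (teC _ d b).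
lra.
Qed.

Lemma vsum_new (B : tetedge Y -> R) c j j' : P j -> P j' -> j != j' ->
  (forall u v w, arr m j j' u v w ->
    [/\ B (new m j, te j v w) = B (new m j, te j j' u) &
     B (new m j, te j j' u) + B (new m j, te j j' v) + B (new m j, te j j' w) = c]) ->
  forall v, vsum B (new m j) v = c.
Proof.
move=> hj hj' jj h v; have [E|pv] := boolP (P (lift j v)).
  have Ej : lift j v = j'.
    by case: (pole_cases hj hj' jj E) => // E2; move: (neq_lift j v); rewrite E2 eqxx.
  have [x [y [z ha]]] := arr_ex1 hj hj' jj.
  by rewrite (vsum_label _ _ (arr_uniq ha) Ej); case: (h _ _ _ ha).
have [y [z ha]] := arr_ex2 hj hj' jj pv.
have u1 : uniq [:: j; lift j v; j'; y; z] by have h1 := arr_uniq ha; uniq5 h1.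
rewrite (vsum_label _ _ u1 erefl) (teC _ _ j').
have [_ <-] := h _ _ _ ha.
have [-> _] := h _ _ _ (arr_rot (arr_rot ha)).
have [E _] := h _ _ _ (arr_rot ha); rewrite teC in E; rewrite E; ring.
Qed.

(** At its pole, the angles of a new tetrahedron add up to the three old vertex sums at that pole
    minus the total angle at e, that is to [3c - 2c]. This is where the weight of e enters. *)
Lemma pachner_map_vsum (A : tetedge X -> R) c :
  (forall t v, vsum A t v = c) -> \sum_a chi a * A a = c + c ->
  forall t v, vsum (pachner_map m A) t v = c.
Proof.
move=> hA hw t' v; have [h1 h2] := pachner_mapP m A.
case: (tet_cover m t') => [[j hj ->]|[t ht ->]]; last first.
  by rewrite -(hA t v); apply: eq_bigr => x _; exact: h1.
have [j' hj' jj] := pole_other hj.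
move: v; apply: (vsum_new hj hj' jj) => x y z h.
have [E1 E2] := h2 _ _ _ _ _ h; rewrite E1 E2; split=> //.
have [-> _] := h2 _ _ _ _ _ (arr_rot h); have [-> _] := h2 _ _ _ _ _ (arr_rot (arr_rot h)).
have q a b d : arr m j j' a b d ->
    A (old m a, te a j j') + A (old m a, te a j' b) + A (old m a, te a j' d) = c.
  move=> ha; have u1 : uniq [:: a; j'; j; b; d] by have h3 := arr_uniq ha; uniq5 h3.
  by rewrite -(vsum_te (hA (old m a)) u1) (teC _ j j').
have := q _ _ _ h; have := q _ _ _ (arr_rot h); have := q _ _ _ (arr_rot (arr_rot h)).
move: hw; rewrite (sum_chi_arr _ h); lra.
Qed.

Lemma J_chi j j' u v w : arr m j j' u v w ->
  [/\ J chi (old m u, te u j v) = arr_sign m R j j' u v w,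
      J chi (old m u, te u j j') = 0 & J chi (old m u, te u v w) = 0].
Proof.
move=> h; rewrite (J_old_ee _ h) (J_old_pp _ h) (J_old_pe _ h).
have [-> -> ->] := chiE h; have [_ _ ->] := chiE (arr_swap h).
have [_ _ ->] := chiE (arr_flip h); have [_ _ ->] := chiE (arr_flip (arr_swap h)).
by split; ring.
Qed.

(** Multiplied by the sign of the arrangement, the values of [D] on edges joining a pole to an
    equatorial vertex are unchanged when passing to the opposite edge ([fa]) and, because a
    component of P D vanishes, when exchanging [u] and [w] ([fb]). These two moves generate all
    relabellings, so [f] is a constant [c]; the vertex sums then force 0 on the other edges of S. *)
Lemma pachner_map_kernel (D : tetedge X -> R) :
  (forall t v, vsum D t v = 0) -> (forall b, pachner_map m D b = 0) ->
  exists c, forall a, D a = c * J chi a.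
Proof.
move=> hD hP; have [h1 h2] := pachner_mapP m D.
pose f j j' u v w := D (old m u, te u j v) * arr_sign m R j j' u v w.
have fa j j' u v w : arr m j j' u v w -> f j' j u w v = f j j' u v w.
  move=> h; rewrite /f arr_sign_swap arr_sign_flip opprK; congr (_ * _).
  have u1 : uniq [:: u; j'; w; j; v] by have h3 := arr_uniq h; uniq5 h3.
  exact: (vsum_opp (hD (old m u)) u1).
have fb j j' u v w : arr m j j' u v w -> f j j' w v u = f j j' u v w.
  move=> h; rewrite /f.
  have h' := arr_rot (arr_swap h).
  have [E _] := h2 _ _ _ _ _ h'; rewrite hP in E.
  have -> : D (old m u, te u j v) = - D (old m w, te w j v) by lra.
  have -> : arr_sign m R j j' w v u = - arr_sign m R j j' u v w.
    by rewrite -(arr_sign_rot m R j j' w v u) -(arr_sign_rot m R j j' v u w) arr_sign_flip.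
  ring.
(* [fa] exchanges the poles and two equatorial vertices, [fb] another pair of equatorial vertices.
   Their composite is a 3-cycle together with the exchange of the poles, so its cube, six moves in
   all, exchanges the poles only. *)
have fs j j' u v w : arr m j j' u v w -> f j' j u v w = f j j' u v w.
  move=> g1.
  have g2 := arr_flip (arr_swap g1); have g3 := arr_flip (arr_rot (arr_rot g2)).
  have g4 := arr_flip (arr_swap g3); have g5 := arr_flip (arr_rot (arr_rot g4)).
  have g6 := arr_flip (arr_swap g5).
  by rewrite (fb _ _ _ _ _ g6) (fa _ _ _ _ _ g5) (fb _ _ _ _ _ g4) (fa _ _ _ _ _ g3) (fb _ _ _ _ _ g2) (fa _ _ _ _ _ g1).
have ff j j' u v w : arr m j j' u v w -> f j j' u w v = f j j' u v w.
  by move=> h; rewrite -(fa _ _ _ _ _ h) (fs _ _ _ _ _ (arr_flip h)).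
have [u0 [v0 [w0 h0]]] := arr_ex1 (P_p m) (P_q m) (pq_neq m).
pose c := f (p32 m) (q32 m) u0 v0 w0.
have fc j j' u v w : arr m j j' u v w -> f j j' u v w = c.
  move=> h; apply: (arr_conn (m := m) (Q := fun j j' u v w => f j j' u v w = c) _ h0 h erefl) => {j j' u v w h} j j' u v w h <-.
  rewrite (fs _ _ _ _ _ h) (ff _ _ _ _ _ h); split=> //.
  by rewrite -(ff _ _ _ _ _ h) -(fb _ _ _ _ _ (arr_flip h)).
have pe j j' u v w : arr m j j' u v w -> D (old m u, te u j v) = c * arr_sign m R j j' u v w.
  by move=> h; rewrite -(fc _ _ _ _ _ h) /f -mulrA arr_sign_sqr // mulr1.
exists c; apply: (tetedgeX_ind (m := m)) => [t x ht|j j' u v w h].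
  rewrite -(h1 _ _ ht) hP -(J_keep (m := m) (G := chi) (G' := fun=> 0) x ht).
    by rewrite J0 mulr0.
  by move=> y; rewrite chi_keep.
have [-> -> ->] := J_chi h; rewrite (pe _ _ _ _ _ h) mulr0; split=> //.
  have u1 : uniq [:: u; j; j'; v; w] by have h3 := arr_uniq h; uniq5 h3.
  have := vsum_te (hD (old m u)) u1.
  by rewrite (pe _ _ _ _ _ h) (pe _ _ _ _ _ (arr_flip h)) arr_sign_flip; lra.
have u1 : uniq [:: u; v; w; j; j'] by have h3 := arr_uniq h; uniq5 h3.
have u2 : uniq [:: u; j; j'; v; w] by have h3 := arr_uniq h; uniq5 h3.
rewrite (vsum_opp (hD (old m u)) u1); have := vsum_te (hD (old m u)) u2.
by rewrite (pe _ _ _ _ _ h) (pe _ _ _ _ _ (arr_flip h)) arr_sign_flip; lra.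
Qed.

(** * The transpose and a section of the angle map *)

Definition adjoint_rel (B : tetedge Y -> R) (A : tetedge X -> R) : Prop :=
  (forall t x, ~~ inS t -> A (t, x) = B (keep m t, x)) /\
  forall j j' u v w, arr m j j' u v w ->
    [/\ A (old m u, te u j j') = 0, A (old m u, te u v w) = 0 &
     A (old m u, te u j v) = B (new m j', te j' j v) + B (new m j', te j' u w)].

Lemma adjoint_ex B : exists A, adjoint_rel B A.
Proof.
apply: (build_old (fun a => B (keep m a.1, a.2)) (Fpp := fun _ _ _ _ _ => 0)
  (Fee := fun _ _ _ _ _ => 0) (fun j j' u v w => B (new m j', te j' j v) + B (new m j', te j' u w))).
by [].
Qed.

Lemma sum_new (F : tedge -> R) j j' u v w : arr m j j' u v w ->
  \sum_x F x = F (te j j' u) + F (te j v w) + F (te j j' v) + F (te j u w)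
    + F (te j j' w) + F (te j u v).
Proof. by move=> h; apply: sum_label; have h1 := arr_uniq h; uniq5 h1. Qed.

(** This identifies [adjoint_rel] as the graph of the transpose of P: the angle of [old m u] at [jv]
    enters P only in [new m j'], at [jv] and at the opposite edge [uw]. *)
Lemma adjoint_relP B A D : adjoint_rel B A ->
  \sum_b B b * pachner_map m D b = \sum_a A a * D a.
Proof.
move=> [a1 a2]; have [h1 h2] := pachner_mapP m D.
have [u [v [w h]]] := arr_ex1 (P_p m) (P_q m) (pq_neq m).
rewrite (sumX _ h) (sumY (m := m) _ (P_p m) (P_q m) (pq_neq m)).
congr (_ + _).
  by apply: eq_bigr => t ht; apply: eq_bigr => x _; rewrite h1 // a1.
have hv := arr_rot h; have hw := arr_rot hv.
rewrite (sum_new _ h) (sum_new _ (arr_swap h)) (sum_old _ h) (sum_old _ hv) (sum_old _ hw).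
move: (h2 _ _ _ _ _ h) (h2 _ _ _ _ _ hv) (h2 _ _ _ _ _ hw).
move: (h2 _ _ _ _ _ (arr_swap h)) (h2 _ _ _ _ _ (arr_swap hv)) (h2 _ _ _ _ _ (arr_swap hw)).
move: (a2 _ _ _ _ _ h) (a2 _ _ _ _ _ hv) (a2 _ _ _ _ _ hw).
move: (a2 _ _ _ _ _ (arr_swap h)) (a2 _ _ _ _ _ (arr_swap hv)) (a2 _ _ _ _ _ (arr_swap hw)).
move: (a2 _ _ _ _ _ (arr_flip h)) (a2 _ _ _ _ _ (arr_flip hv)) (a2 _ _ _ _ _ (arr_flip hw)).
move: (a2 _ _ _ _ _ (arr_flip (arr_swap h))) (a2 _ _ _ _ _ (arr_flip (arr_swap hv))) (a2 _ _ _ _ _ (arr_flip (arr_swap hw))).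
norm (p32 m) (q32 m) u v w.
do 3 (case=> _ _ ->); do 3 (case=> _ _ ->); do 3 (case=> _ _ ->); do 3 (case=> -> -> ->).
do 6 (case=> -> ->); ring.
Qed.

(** The identity P J P^T = J. In the two rows that P adds, the terms coming from the other new
    tetrahedron, at [ju] and [vw], occur with opposite signs. *)
Lemma adjoint_J B A : adjoint_rel B A -> pachner_rel m (J A) (J B).
Proof.
move=> [a1 a2]; split=> [t x ht|j j' u v w h].
  by apply: J_keep => // y; rewrite a1.
have h3 : arr m j' j v u w by do 2 apply: arr_rot; apply/arr_flip/arr_swap.
have h4 : arr m j' j w u v by do 2 apply: arr_rot; apply: arr_swap.
rewrite (J_new_ee _ h) (J_new _ h) (J_old_pe _ h3) (J_old_pe _ h4).
have -> : arr_sign m R j' j v u w = arr_sign m R j j' u v w.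
  by rewrite -(arr_sign_rot m R j' j) arr_sign_flip arr_sign_swap arr_sign_rot opprK.
have -> : arr_sign m R j' j w u v = - arr_sign m R j j' u v w by rewrite -(arr_sign_rot m R j' j) arr_sign_swap.
move: (a2 _ _ _ _ _ h3) (a2 _ _ _ _ _ h4).
move: (a2 _ _ _ _ _ (arr_flip h3)) (a2 _ _ _ _ _ (arr_flip h4)).
move: (a2 _ _ _ _ _ (arr_swap h3)) (a2 _ _ _ _ _ (arr_swap h4)).
norm j j' u v w.
do 2 (case=> _ _ ->); do 2 (case=> _ _ ->); do 2 (case=> -> -> _).
by split; ring.
Qed.

(* Among the solutions of the linear system given by the move, the one invariant
   under the symmetries of the bipyramid. *)
Definition section_rel (B : tetedge Y -> R) (A : tetedge X -> R) : Prop :=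
  let N j j' u := B (new m j, te j j' u) in
  (forall t x, ~~ inS t -> A (t, x) = B (keep m t, x)) /\
  forall j j' u v w, arr m j j' u v w ->
    [/\ A (old m u, te u j j') = N j j' u + N j' j u,
        A (old m u, te u v w) = N j j' u + N j' j u &
     A (old m u, te u j v) = (N j' j v - N j j' v - N j' j u - 2 * N j j' u) / 3 +
      (N j j' u + N j j' v + N j j' w + N j' j u + N j' j v + N j' j w) / 4].

Lemma section_ex B : exists A, section_rel B A.
Proof.
pose N j j' u := B (new m j, te j j' u).
apply: (build_old (m := m) (fun a => B (keep m a.1, a.2))
  (Fpp := fun j j' u v w => N j j' u + N j' j u)
  (Fee := fun j j' u v w => N j j' u + N j' j u)
  (fun j j' u v w => (N j' j v - N j j' v - N j' j u - 2 * N j j' u) / 3 +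
      (N j j' u + N j j' v + N j j' w + N j' j u + N j' j v + N j' j w) / 4)).
by move=> j j' u v w _; split; rewrite // addrC.
Qed.

Definition pachner_section B : tetedge X -> R := sval (cid (section_ex B)).

Lemma pachner_sectionP B : section_rel B (pachner_section B).
Proof. exact: (svalP (cid (section_ex B))). Qed.

Lemma section_rel_uniq B A a : section_rel B A -> A a = pachner_section B a.
Proof.
move=> [h1 h2]; have [h3 h4] := pachner_sectionP B; move: a; apply: (tetedgeX_ind (m := m)) => [t x ht|j j' u v w h] /=.
  by rewrite h1 // h3.
by have [-> -> ->] := h2 _ _ _ _ _ h; have [-> -> ->] := h4 _ _ _ _ _ h.
Qed.

Lemma pachner_section_lin c B B' a : pachner_section (fun b => c * B b + B' b) a = c * pachner_section B a + pachner_section B' a.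
Proof.
apply/esym/(section_rel_uniq (A := fun a => c * pachner_section B a + pachner_section B' a)).
have [h1 h2] := pachner_sectionP B; have [h3 h4] := pachner_sectionP B'.
split=> [t x ht|j j' u v w h]; first by rewrite h1 // h3.
by have [-> -> ->] := h2 _ _ _ _ _ h; have [-> -> ->] := h4 _ _ _ _ _ h; split; field.
Qed.

Lemma vsum_Nsum (B : tetedge Y -> R) c : (forall t v, vsum B t v = c) ->
  forall j j' u v w, arr m j j' u v w ->
  [/\ B (new m j, te j v w) = B (new m j, te j j' u),
   B (new m j, te j j' u) + B (new m j, te j j' v) + B (new m j, te j j' w) = c &
   B (new m j', te j' j u) + B (new m j', te j' j v) + B (new m j', te j' j w) = c].
Proof.
move=> hB j j' u v w h; have h1 := arr_uniq h; split.
- have u1 : uniq [:: j; v; w; j'; u] by uniq5 h1.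
  exact: (vsum_opp (hB (new m j)) u1).
- have u1 : uniq [:: j; j'; u; v; w] by uniq5 h1.
  exact: (vsum_te (hB (new m j)) u1).
- have u1 : uniq [:: j'; j; u; v; w] by uniq5 h1.
  exact: (vsum_te (hB (new m j')) u1).
Qed.

(** The six new angles at the poles add up to [2c], so the summand with denominator 4 is [c / 2].
    The two edges joining a pole to an equatorial vertex thus contribute [c], and the thirds add up
    to minus the value at the remaining edge. *)
Lemma pachner_section_vsum (B : tetedge Y -> R) c : (forall t v, vsum B t v = c) ->
  forall t v, vsum (pachner_section B) t v = c.
Proof.
move=> hB t; have [h1 h2] := pachner_sectionP B.
case: (boolP (inS t)) => ht; last first.
  move=> v; rewrite -(hB (keep m t) v); apply: eq_bigr => x _; exact: h1.
case/existsP: ht => u /andP[hu /eqP ->].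
have main j j' v w : arr m j j' u v w -> pachner_section B (old m u, te u j j') +
   pachner_section B (old m u, te u j v) + pachner_section B (old m u, te u j w) = c.
  move=> h; have [_ n1 n2] := vsum_Nsum hB h.
  have [-> _ ->] := h2 _ _ _ _ _ h; have [_ _ ->] := h2 _ _ _ _ _ (arr_flip h).
  lra.
have main' j j' v w : arr m j j' u v w -> pachner_section B (old m u, te u v w) +
   pachner_section B (old m u, te u v j) + pachner_section B (old m u, te u v j') = c.
  move=> h; have [_ n1 n2] := vsum_Nsum hB h; rewrite (teC _ v j) (teC _ v j').
  have [_ -> ->] := h2 _ _ _ _ _ h; have [_ _ ->] := h2 _ _ _ _ _ (arr_swap h).
  lra.
move=> v; have [E|pv] := boolP (P (lift u v)).
  have [j' hj' jj] := pole_other E; have [y [z ha]] := arr_ex2 E hj' jj hu.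
  have u1 : uniq [:: u; lift u v; j'; y; z] by have h3 := arr_uniq ha; uniq5 h3.
  by rewrite (vsum_label _ _ u1 erefl); exact: main ha.
have uv : u != lift u v by exact: neq_lift.
have [y ha] := arr_ex3 (P_p m) (P_q m) (pq_neq m) hu pv uv.
have u1 : uniq [:: u; lift u v; y; p32 m; q32 m] by have h3 := arr_uniq ha; uniq5 h3.
by rewrite (vsum_label _ _ u1 erefl); exact: main' ha.
Qed.

Lemma pachner_section_weight (B : tetedge Y -> R) c : (forall t v, vsum B t v = c) ->
  \sum_a chi a * pachner_section B a = c + c.
Proof.
move=> hB; have [h1 h2] := pachner_sectionP B.
have [u [v [w h]]] := arr_ex1 (P_p m) (P_q m) (pq_neq m).
have [_ n1 n2] := vsum_Nsum hB h.
rewrite (sum_chi_arr _ h); have [-> _ _] := h2 _ _ _ _ _ h.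
have [-> _ _] := h2 _ _ _ _ _ (arr_rot h).
have [-> _ _] := h2 _ _ _ _ _ (arr_rot (arr_rot h)); lra.
Qed.

Lemma pachner_sectionK (B : tetedge Y -> R) c : (forall t v, vsum B t v = c) ->
  forall b, pachner_map m (pachner_section B) b = B b.
Proof.
move=> hB b; have [h1 h2] := pachner_sectionP B; apply/esym; apply: pachner_rel_uniq.
split=> [t x ht|j j' u v w h]; first by rewrite h1.
have [E n1 n2] := vsum_Nsum hB h; rewrite E.
have h3 : arr m j' j v u w by do 2 apply: arr_rot; apply/arr_flip/arr_swap.
have h4 : arr m j' j w u v by do 2 apply: arr_rot; apply: arr_swap.
have [_ _ ->] := h2 _ _ _ _ _ h3; have [_ _ ->] := h2 _ _ _ _ _ h4.
by split; lra.
Qed.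

(** The origin of the constant 12. P preserves the weights on the boundary edges of the bipyramid
    and e has weight [2 * pi], so the levels differ by [- 2 * g] and by the summands 1/3, which
    count tetrahedra: 2 against 1 at an edge joining a pole to an equatorial vertex, 1 against 2 at
    an equatorial edge, 3 against 0 at e. With E and Q the sums of [G] over these two kinds of
    boundary edges, [lev G] exceeds [lev G'] by (E - Q) / 3 - g, while the pairing of [J chi] with
    [J G] is 12 g + 4 Q - 4 E. *)
Lemma lev_pachner_map (A G : tetedge X -> R) (G' : tetedge Y -> R) g :
  (forall t v, vsum A t v = pi) -> \sum_a chi a * A a = pi + pi ->
  compat m G G' -> inner_const m G g ->
  lev G A + (\sum_a J chi a * J G a) / 12 = lev G' (pachner_map m A).
Proof.
move=> hA hw [c1 c2] hg; have [h1 h2] := pachner_mapP m A.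
have one j j' a b d : arr m j j' a b d ->
    \sum_x G (old m a, x) * (3%:R^-1 - A (old m a, x) / pi) =
    (g + G (old m a, te a b d)) *
      (3%:R^-1 - (pi - A (old m a, te a j b) - A (old m a, te a j d)) / pi)
    + (G (old m a, te a j b) + G (old m a, te a j' d)) * (3%:R^-1 - A (old m a, te a j b) / pi)
    + (G (old m a, te a j d) + G (old m a, te a j' b)) * (3%:R^-1 - A (old m a, te a j d) / pi).
  move=> ha; rewrite (sum_old _ ha) (hg _ _ _ _ _ ha); have u0 := arr_uniq ha.
  have u1 : uniq [:: a; j; j'; b; d] by uniq5 u0.
  have u2 : uniq [:: a; j'; d; j; b] by uniq5 u0.
  have u3 : uniq [:: a; j'; b; j; d] by uniq5 u0.
  have <- := vsum_te (hA (old m a)) u1.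
  rewrite -(vsum_opp (hA (old m a)) u1) (vsum_opp (hA (old m a)) u2) (vsum_opp (hA (old m a)) u3).
  move: (_^-1) => c; ring.
have JJ j j' a b d : arr m j j' a b d ->
    J chi (old m a, te a j b) * J G (old m a, te a j b) =
    g + G (old m a, te a b d) - G (old m a, te a j d) - G (old m a, te a j' b).
  move=> ha; have [-> _ _] := J_chi ha.
  by rewrite (J_old_pe _ ha) mulrA arr_sign_sqr // mul1r (hg _ _ _ _ _ ha).
have two j j' a b d : arr m j j' a b d ->
    \sum_x J chi (old m a, x) * J G (old m a, x) = 4 * (g + G (old m a, te a b d))
     - 2 * (G (old m a, te a j b) + G (old m a, te a j d) + G (old m a, te a j' b) + G (old m a, te a j' d)).
  move=> ha; rewrite (sum_old _ ha) (JJ _ _ _ _ _ ha) (JJ _ _ _ _ _ (arr_flip ha)).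
  rewrite (JJ _ _ _ _ _ (arr_swap ha)) (JJ _ _ _ _ _ (arr_flip (arr_swap ha))).
  have [_ -> ->] := J_chi ha; rewrite (teC _ d b); ring.
have [u [v [w h]]] := arr_ex1 (P_p m) (P_q m) (pq_neq m).
have hv := arr_rot h; have hw' := arr_rot hv.
rewrite /lev (sumX _ h) (sumX (fun a => J chi a * J G a) h).
rewrite (sumY (m := m) _ (P_p m) (P_q m) (pq_neq m)).
rewrite [X in (X + _) / 12]big1 ?add0r => [|t ht]; last first.
  apply: big1 => x _; rewrite -(J_keep (m := m) (G := chi) (G' := fun=> 0) x ht).
    by rewrite J0 mul0r.
  by move=> y; rewrite chi_keep.
rewrite -addrA; congr (_ + _).
  by apply: eq_bigr => t ht; apply: eq_bigr => x _; rewrite h1 // c1.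
rewrite (one _ _ _ _ _ h) (one _ _ _ _ _ hv) (one _ _ _ _ _ hw').
rewrite (two _ _ _ _ _ h) (two _ _ _ _ _ hv) (two _ _ _ _ _ hw').
rewrite (sum_new _ h) (sum_new _ (arr_swap h)).
have hpp a b d : arr m (p32 m) (q32 m) a b d -> A (old m a, te a (p32 m) (q32 m)) =
    pi - A (old m a, te a (p32 m) b) - A (old m a, te a (p32 m) d).
  move=> ha; have u0 := arr_uniq ha.
  have u1 : uniq [:: a; p32 m; q32 m; b; d] by uniq5 u0.
  by have := vsum_te (hA (old m a)) u1; lra.
have hop a b d : arr m (p32 m) (q32 m) a b d ->
    A (old m a, te a (q32 m) d) = A (old m a, te a (p32 m) b).
  move=> ha; have u0 := arr_uniq ha.
  have u2 : uniq [:: a; q32 m; d; p32 m; b] by uniq5 u0.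
  exact: (vsum_opp (hA (old m a)) u2).
move: hw; rewrite (sum_chi_arr _ h) (hpp _ _ _ h) (hpp _ _ _ hv) (hpp _ _ _ hw').
move: (h2 _ _ _ _ _ h) (h2 _ _ _ _ _ hv) (h2 _ _ _ _ _ hw').
move: (h2 _ _ _ _ _ (arr_swap h)) (h2 _ _ _ _ _ (arr_swap hv)) (h2 _ _ _ _ _ (arr_swap hw')).
rewrite (hop _ _ _ h) (hop _ _ _ hv) (hop _ _ _ hw').
rewrite (hop _ _ _ (arr_flip h)) (hop _ _ _ (arr_flip hv)) (hop _ _ _ (arr_flip hw')).
move: (c2 _ _ _ _ _ h) (c2 _ _ _ _ _ hv) (c2 _ _ _ _ _ hw').
move: (c2 _ _ _ _ _ (arr_swap h)) (c2 _ _ _ _ _ (arr_swap hv)) (c2 _ _ _ _ _ (arr_swap hw')).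
move: (c2 _ _ _ _ _ (arr_flip h)) (c2 _ _ _ _ _ (arr_flip hv)) (c2 _ _ _ _ _ (arr_flip hw')).
move: (c2 _ _ _ _ _ (arr_flip (arr_swap h))) (c2 _ _ _ _ _ (arr_flip (arr_swap hv))) (c2 _ _ _ _ _ (arr_flip (arr_swap hw'))).
norm (p32 m) (q32 m) u v w.
do 3 (case=> <- _); do 3 (case=> <- _).
do 3 (case=> <- ->); do 3 (case=> <- ->).
do 6 (case=> -> ->); move=> hsum.
have /lt0r_neq0 hpi := pi_gt0 R; move: (pi : R) hpi hsum => c hc hsum.
(* The weight of e is the last relation among the six remaining angles; it eliminates one of
   them. *)
have -> : A (old m w, te w (p32 m) v) = c - A (old m u, te u (p32 m) v)
  - A (old m u, te u (p32 m) w) - A (old m v, te v (p32 m) w) - A (old m v, te v (p32 m) u)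
  - A (old m w, te w (p32 m) u) by lra.
by field.
Qed.
End Gauge_transport.

Local Open Scope classical_set_scope.

(** * Smooth functions and brackets *)

Section Smooth.
Variable R : realType.

Lemma linear_pack (V W : normedModType R) (f : V -> W) : linear f ->
  exists g : {linear V -> W}, f = g.
Proof.
move=> h; pose fl := GRing.isLinear.Build R V W _ f h.
by exists (HB.pack_for {linear V -> W} f fl).
Qed.

Lemma rV_linear_continuous n (W : normedModType R) (f : 'rV[R]_n -> W) :
  linear f -> continuous f.
Proof.
move=> /linear_pack[g ->] x.
apply: differentiable_continuous.
have -> : (g : 'rV[R]_n -> W) = \sum_(i < n) (fun u : 'rV[R]_n => u 0 i *: g (delta_mx 0 i)).
  apply/funext => u; rewrite {1}(row_sum_delta u) linear_sum fct_sumE.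
  by apply: eq_bigr => i _; rewrite linearZ.
apply: differentiable_sum => i; apply: differentiableZl.
exact: differentiable_coord.
Qed.

Lemma prod_linear_continuous n (W : normedModType R) (f : 'rV[R]_n * R -> W) :
  linear f -> continuous f.
Proof.
move=> hf x.
have fl : linear (fun u : 'rV[R]_n => f (u, 0)).
  by move=> a u v; rewrite -hf; congr f; apply: injective_projections;
    rewrite /= ?scaler0 ?addr0.
have -> : f = (fun z => f (z.1, 0) + z.2 *: f (0, 1)).
  apply/funext => -[u l] /=; rewrite addrC -hf; congr f.
  by apply: injective_projections; rewrite /= ?scaler0 ?add0r ?addr0 // -[RHS]/(l * 1) mulr1.
apply: cvgD.
  apply: (@continuous_comp _ _ _ fst (fun u => f (u, 0))); first exact: cvg_fst.
  exact: rV_linear_continuous.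
apply: cvgZr_tmp; exact: cvg_snd.
Qed.

Lemma derive_comp_linear (V W : normedModType R) (f : V -> W) (F : W -> R) x v :
  linear f -> continuous f -> differentiable F (f x) ->
  'D_v (F \o f) x = 'D_(f v) F (f x).
Proof.
move=> /linear_pack[g ->] gc dF.
have dg := linear_differentiable x gc.
rewrite !deriveE //; last exact: differentiable_comp.
by rewrite diff_comp //= diff_lin.
Qed.

Lemma smooth_comp_linear (V W : normedModType R) (f : V -> W) (F : W -> R) :
  linear f -> continuous f -> smooth F -> smooth (F \o f).
Proof.
move=> fl fc sF.
have E vs : iter_derive vs (F \o f) = iter_derive (map f vs) F \o f.
  elim: vs => //= v vs ->; apply/funext => x.
  by rewrite derive_comp_linear //; exact: sF.
move=> vs x; rewrite E; apply: (@differentiable_comp _ _ _ _ f); last exact: sF.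
by have [g eg] := linear_pack fl; rewrite eg in fc *; exact: linear_differentiable.
Qed.

(** Only the restrictions to two parallel lines matter. The base points may differ, which serves to
    change the extension of a function as well as the representative of a class. *)
Lemma derive_congr (V : normedModType R) (F G : V -> R) x y v :
  (forall h : R, F (h *: v + x) = G (h *: v + y)) -> 'D_v F x = 'D_v G y.
Proof.
move=> h; rewrite /derive.
have h0 := h 0; rewrite !scale0r !add0r in h0.
suff -> : (fun t : R => t^-1 *: ((F \o shift x) (t *: v) - F x)) =
  (fun t : R => t^-1 *: ((G \o shift y) (t *: v) - G y)) by [].
by apply/funext => t /=; rewrite h h0.
Qed.
End Smooth.

(** * Brackets in coordinates *)

Section Coordinates.
Variables (R : realType) (X : pseudo3).
Implicit Types (u v : tetedge X -> R) (F G : 'rV[R]_#|tetedge X| -> R).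

Definition vec u : 'rV[R]_#|tetedge X| := \row_i u (enum_val i).
Definition unvec (x : 'rV[R]_#|tetedge X|) : tetedge X -> R := fun a => x 0 (enum_rank a).

Lemma vecK u a : unvec (vec u) a = u a.
Proof. by rewrite /unvec mxE enum_rankK. Qed.

Lemma vec_lin c u v : vec (fun a => c * u a + v a) = c *: vec u + vec v.
Proof. by apply/rowP => i; rewrite !mxE. Qed.

Lemma vec_eq u v : (forall a, u a = v a) -> vec u = vec v.
Proof. by move=> h; apply/rowP => i; rewrite !mxE h. Qed.

Lemma derive_vec F x u : differentiable F x ->
  'D_(vec u) F x = \sum_a u a * pderiv a F x.
Proof.
move=> dF; rewrite deriveE // {1}(row_sum_delta (vec u)) linear_sum.
rewrite (reindex (@enum_rank (tetedge X))) /=; last by apply: onW_bij; exact: enum_rank_bij.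
by apply: eq_bigr => a _; rewrite linearZ /pderiv deriveE // mxE enum_rankK.
Qed.

Lemma NZ_J F G x : NZbracket F G x =
  \sum_a pderiv a F x * J (fun b => pderiv b G x) a.
Proof.
rewrite /NZbracket; apply: eq_bigr => a _; rewrite big_distrr; apply: eq_bigr => b _ /=.
by rewrite mulrA [pderiv a F x * _]mulrC.
Qed.

Lemma NZ_derive F G x : differentiable F x ->
  NZbracket F G x = 'D_(vec (J (fun b => pderiv b G x))) F x.
Proof. by move=> dF; rewrite derive_vec // NZ_J; apply: eq_bigr => a _; rewrite mulrC. Qed.

Lemma NZ_skew F G x : NZbracket F G x = - NZbracket G F x.
Proof. by rewrite !NZ_J J_skew. Qed.

(* Changing [F] and [G] one at a time, the Hamiltonian vector field of the
   other one being tangent to the subspace where the functions agree. *)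
Lemma NZ_congr F G F' G' x x' (T : (tetedge X -> R) -> Prop) :
  differentiable F x -> differentiable G x ->
  differentiable F' x' -> differentiable G' x' ->
  (forall u, T u -> 'D_(vec u) F x = 'D_(vec u) F' x') ->
  (forall u, T u -> 'D_(vec u) G x = 'D_(vec u) G' x') ->
  T (J (fun b => pderiv b G x)) -> T (J (fun b => pderiv b F' x')) ->
  NZbracket F G x = NZbracket F' G' x'.
Proof.
move=> dF dG dF' dG' hF hG tG tF.
rewrite NZ_derive // hF // derive_vec // [RHS]NZ_skew NZ_derive // -hG // derive_vec //.
have S (A B : tetedge X -> R) : \sum_a A a * B a = \sum_a B a * A a.
  by apply: eq_bigr => a _; rewrite mulrC.
by rewrite [LHS]S J_skew; congr (- _); exact: S.
Qed.
End Coordinates.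

(** * The move as a linear map of coordinates *)

Section Map.
Variables (X Y : pseudo3) (e : edge X) (m : pachner32 Y e) (R : realType).

Definition pvec (x : 'rV[R]_#|tetedge X|) : 'rV[R]_#|tetedge Y| := vec (pachner_map m (unvec x)).
Definition svec (x : 'rV[R]_#|tetedge Y|) : 'rV[R]_#|tetedge X| := vec (pachner_section m (unvec x)).

Lemma unvec_lin (Z : pseudo3) c (x y : 'rV[R]_#|tetedge Z|) :
  unvec (c *: x + y) = (fun a => c * unvec x a + unvec y a).
Proof. by apply/funext => a; rewrite /unvec !mxE. Qed.

Lemma pvec_linear : linear pvec.
Proof.
move=> c x y; rewrite /pvec unvec_lin -vec_lin; apply: vec_eq => a; exact: pachner_map_lin.
Qed.

Lemma svec_linear : linear svec.
Proof.
move=> c x y; rewrite /svec unvec_lin -vec_lin; apply: vec_eq => a; exact: pachner_section_lin.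
Qed.

Lemma vec_unvec (Z : pseudo3) (A : tetedge Z -> R) : unvec (vec A) = A.
Proof. by apply/funext => a; rewrite vecK. Qed.

Lemma pvec_vec A : pvec (vec A) = vec (pachner_map m A).
Proof. by rewrite /pvec vec_unvec. Qed.

Lemma svec_vec A : svec (vec A) = vec (pachner_section m A).
Proof. by rewrite /svec vec_unvec. Qed.

Lemma pderiv_pvec (F : 'rV[R]_#|tetedge Y| -> R) (A : tetedge X -> R) x a :
  differentiable F (pvec x) -> adjoint_rel m (fun b => pderiv b F (pvec x)) A ->
  pderiv a (F \o pvec) x = A a.
Proof.
move=> dF hA; rewrite /pderiv derive_comp_linear //; last first.
- exact: rV_linear_continuous pvec_linear.
- exact: pvec_linear.
rewrite {1}/pvec derive_vec //; set D := unvec _.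
have := adjoint_relP D hA.
under eq_bigr do rewrite mulrC; move=> ->.
rewrite (bigD1 a) //= {1}/D /unvec mxE !eqxx mulr1 big1 ?addr0 // => b hb.
by rewrite /D /unvec mxE eqxx /= (inj_eq enum_rank_inj) (negbTE hb) mulr0.
Qed.

(** Gradients pull back by the transpose of P, so the left bracket pairs the gradient of [F] with P
    J P^T applied to that of [G]. *)
Lemma NZ_pvec (F G : 'rV[R]_#|tetedge Y| -> R) x :
  differentiable F (pvec x) -> differentiable G (pvec x) ->
  NZbracket (F \o pvec) (G \o pvec) x = NZbracket F G (pvec x).
Proof.
move=> dF dG; have [A hA] := adjoint_ex m (fun b => pderiv b F (pvec x)).
have [B hB] := adjoint_ex m (fun b => pderiv b G (pvec x)).
have EA : (fun a => pderiv a (F \o pvec) x) = A by apply/funext => a; exact: pderiv_pvec.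
have EB : (fun a => pderiv a (G \o pvec) x) = B by apply/funext => a; exact: pderiv_pvec.
rewrite !NZ_J EB; under eq_bigr => a _ do rewrite (congr1 (fun f => f a) EA).
rewrite -(adjoint_relP (J B) hA); apply: eq_bigr => b _; congr (_ * _).
by apply/esym/pachner_rel_uniq/adjoint_J.
Qed.
End Map.

(** * Gauge classes *)

Section Gauge_classes.
Variables (X Y : pseudo3) (e : edge X) (m : pachner32 Y e) (R : realType).
Variable alY : gshape R Y.

Lemma two_pi : 2 * pi = pi + pi :> R.
Proof. by rewrite mulrDl mul1r. Qed.

Lemma gshape_vsum (Z : pseudo3) (al : gshape R Z) t v : vsum al t v = pi.
Proof. by rewrite -vsumE; exact: angle_sum. Qed.

Lemma gshape_ex (Z : pseudo3) (A : tetedge Z -> R) : (forall t v, vsum A t v = pi) ->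
  exists al : gshape R Z, angle al = A.
Proof.
move=> hA; have h t v : \sum_(a : tetedge Z | (a.1 == t) && ends a.2 v) A a = pi.
  by rewrite vsumE.
by exists (GShape h).
Qed.

Lemma weightE (al : gshape R X) : weight al e = \sum_a chi m R a * al a.
Proof. by rewrite sum_chi. Qed.

Lemma isgauge_inner (G : tetedge X -> R) : isgauge G -> exists c, inner_const m G c.
Proof.
move=> /isgauge_edge[g _ hg]; exists (g e) => j j' u v w h; rewrite hg; congr g.
by have [h1 _ _] := chiE R h; move: h1; rewrite chi_phi; case: eqP => // _ /eqP; rewrite eq_sym oner_eq0.
Qed.

Lemma weight_gauge (al be : gshape R X) : gauge_equiv al be -> weight al e = weight be e.
Proof.
case/gauge_equivP => G hG h; rewrite !weightE.
have -> : \sum_a chi m R a * be a = \sum_a chi m R a * al a + pi * \sum_a chi m R a * J G a.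
  by rewrite big_distrr -big_split; apply: eq_bigr => a _; rewrite h /=; ring.
by rewrite (J_isgauge (chi_gauge m R) hG) mulr0 addr0.
Qed.

Lemma level_setE (al : gshape R X) :
  level_set e (2 * pi) (cls (@gauge_equiv R X) al) <-> weight al e = 2 * pi.
Proof.
rewrite /level_set /weight_r.
by rewrite -(@weight_gauge al) //; apply/cls_gauge; rewrite cls_rep.
Qed.

Lemma pachner_shape_ex (al : gshape R X) : exists al' : gshape R Y,
  weight al e = 2 * pi -> forall b, al' b = pachner_map m al b.
Proof.
(* Shapes of any other weight at e go to the default value [alY], which makes the map total. *)
case: (pselect (weight al e = 2 * pi)) => h; last by exists alY.
have [al' E] : exists al' : gshape R Y, angle al' = pachner_map m al.
  apply: gshape_ex; apply: pachner_map_vsum; first exact: gshape_vsum.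
  by rewrite -two_pi -weightE.
by exists al' => _ b; rewrite E.
Qed.

Definition pachner_shape (al : gshape R X) : gshape R Y := sval (cid (pachner_shape_ex al)).

Lemma pachner_shapeE (al : gshape R X) : weight al e = 2 * pi -> forall b, pachner_shape al b = pachner_map m al b.
Proof. exact: (svalP (cid (pachner_shape_ex al))). Qed.

Lemma section_shape_ex (be : gshape R Y) : exists al : gshape R X, angle al = pachner_section m be.
Proof. apply: gshape_ex; apply: pachner_section_vsum; exact: gshape_vsum. Qed.

Definition section_shape be := sval (cid (section_shape_ex be)).

Lemma section_shapeE be : angle (section_shape be) = pachner_section m be.
Proof. exact: (svalP (cid (section_shape_ex be))). Qed.

Lemma section_shape_weight be : weight (section_shape be) e = 2 * pi.
Proof. by rewrite weightE section_shapeE two_pi; apply: pachner_section_weight; exact: gshape_vsum. Qed.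

Lemma pachner_shape_section be b : pachner_shape (section_shape be) b = be b.
Proof.
rewrite pachner_shapeE; last exact: section_shape_weight.
by rewrite section_shapeE; apply: pachner_sectionK; exact: gshape_vsum.
Qed.

Lemma gauge_fwd (al be : gshape R X) G G' c : compat m G G' -> inner_const m G c ->
  (forall a, be a = al a + pi * J G a) ->
  forall b, pachner_map m be b = pachner_map m al b + pi * J G' b.
Proof.
move=> hc hi h b; have -> : angle be = (fun a => pi * J G a + al a).
  by apply/funext => a; rewrite h addrC.
by rewrite pachner_map_lin addrC -(pachner_rel_uniq b (compat_J hc hi)).
Qed.

(** Any lift of [G'] to X explains the difference of the two shapes up to a tangent vector killed by
    P. Such a vector is a multiple of [J chi], so it is absorbed by changing the value of the lift
    at e. *)
Lemma gauge_bwd (al be : gshape R X) G' : isgauge G' ->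
  (forall b, pachner_map m be b = pachner_map m al b + pi * J G' b) ->
  exists G c, [/\ isgauge G, compat m G G', inner_const m G c &
    forall a, be a = al a + pi * J G a].
Proof.
move=> hG' h; have [G hc [hG hi]] := compat_ex_old m 0 hG'.
pose D a := - 1 * (pi * J G a + al a) + be a.
have DJ : D = (fun a => -1 * (pi * J G a + al a) + be a) by [].
have hD t v : vsum D t v = 0.
  by rewrite DJ vsum_lin vsum_lin J_vtangent !gshape_vsum; ring.
have pD b : pachner_map m D b = 0.
  by rewrite DJ pachner_map_lin pachner_map_lin h -(pachner_rel_uniq b (compat_J hc hi)); ring.
have [c hcD] := pachner_map_kernel hD pD.
have /lt0r_neq0 hpi := pi_gt0 R.
(* The division by [pi] compensates the factor [pi] of the gauge action. *)
exists (fun a => c / pi * chi m R a + G a), (c / pi); split.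
- by apply: isgauge_lin => //; exact: chi_gauge.
- have [c1 c2] := hc; have [d1 d2] := chi_compat m R.
  split=> [t x ht|j j' u v w hh]; first by rewrite c1 // -d1 // mulr0 add0r.
  have [-> ->] := c2 _ _ _ _ _ hh; have [<- <-] := d2 _ _ _ _ _ hh.
  by rewrite mulr0 !add0r.
- move=> j j' u v w hh; rewrite (hi _ _ _ _ _ hh) (chi_inner R hh); ring.
- move=> a; have := hcD a; rewrite DJ J_lin => E.
  have -> : be a = c * J (chi m R) a + (pi * J G a + al a) by rewrite -E; ring.
  by move: pi hpi => p hp; field.
Qed.

Definition pachner_r (c : Sr R X) : Sr R Y := cls _ (pachner_shape (rep c)).

Lemma pachner_shape_gauge (al be : gshape R X) : weight al e = 2 * pi ->
  gauge_equiv al be -> gauge_equiv (pachner_shape al) (pachner_shape be).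
Proof.
move=> hw hg; have hw' := weight_gauge hg; move: hg => /gauge_equivP[G hG h].
have [G' hc hG'] := compat_ex_new m hG; have [c hi] := isgauge_inner hG.
apply/gauge_equivP; exists G' => // b.
by rewrite !pachner_shapeE -?hw' // (gauge_fwd hc hi h).
Qed.

Lemma pachner_r_cls (al : gshape R X) : weight al e = 2 * pi -> pachner_r (cls _ al) = cls _ (pachner_shape al).
Proof.
move=> hw; apply/esym/cls_gauge/pachner_shape_gauge => //.
by apply/cls_gauge; rewrite cls_rep.
Qed.

Lemma level_set_rep (c : Sr R X) : level_set e (2 * pi) c -> weight (rep c) e = 2 * pi.
Proof. by []. Qed.

Lemma vlabel_te k (x : tedge) (a b : 'I_5) :
  vlabel k x = finset (pred2 a b) -> x = te k a b.
Proof.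
move=> /setP h; rewrite (te_lift k x).
have hab : lift k (val x).1 != lift k (val x).2.
  by rewrite (inj_eq lift_inj) neq_ltn (valP x).
have := h (lift k (val x).1); have := h (lift k (val x).2).
rewrite !inE !eqxx orbT /= => /esym/orP[]/eqP E2 /esym/orP[]/eqP E1;
  rewrite E1 E2 ?eqxx // in hab *.
exact: teC.
Qed.

Lemma pachner_shape_angles (al : gshape R X) : weight al e = 2 * pi -> pachner_angles m al (pachner_shape al).
Proof.
move=> hw; have [h1 h2] := pachner_mapP m al; split=> [t x ht|]; first by rewrite pachner_shapeE // h1.
move=> j j' u v w x y z hu hj hj' hx /vlabel_te-> /vlabel_te->.
have h : arr m j j' u v w by rewrite /arr hu hj hj'.
rewrite pachner_shapeE //; have [E1 E2] := h2 _ _ _ _ _ h.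
by case: hx => /vlabel_te->.
Qed.

Lemma pachner_r_induced : pachner_induced m pachner_r.
Proof.
by move=> al hw; exists (pachner_shape al); [exact: pachner_shape_angles | exact: pachner_r_cls].
Qed.

Lemma coordE (Z : pseudo3) (al : gshape R Z) : coord al = vec al.
Proof. by []. Qed.

Lemma coord_pachner_shape (al : gshape R X) : weight al e = 2 * pi -> coord (pachner_shape al) = pvec m (coord al).
Proof. by move=> hw; rewrite coordE coordE pvec_vec; apply: vec_eq => b; exact: pachner_shapeE. Qed.

Lemma coord_section_shape be : coord (section_shape be) = svec m (coord be).
Proof. by rewrite coordE coordE svec_vec section_shapeE. Qed.

Lemma cls_section_shape be : pachner_r (cls _ (section_shape be)) = cls _ be.
Proof.
rewrite pachner_r_cls; last exact: section_shape_weight.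
apply/cls_gauge/gauge_equivP; exists (fun=> 0); first exact: isgauge0.
by move=> b; rewrite pachner_shape_section J0 mulr0 addr0.
Qed.

Lemma pachner_r_bij : set_bij (level_set e (2 * pi)) setT pachner_r.
Proof.
split=> [c _ //|c d|c _].
  rewrite !inE => /level_set_rep hc /level_set_rep hd /cls_gauge/gauge_equivP[G' hG'].
  move=> h; have h' b : pachner_map m (rep d) b = pachner_map m (rep c) b + pi * J G' b.
    by rewrite -!pachner_shapeE.
  have [G [k [hG _ _ E]]] := gauge_bwd hG' h'.
  by rewrite -(cls_rep c) -(cls_rep d); apply/cls_gauge/gauge_equivP; exists G.
exists (cls _ (section_shape (rep c))); first exact/level_setE/section_shape_weight.
by rewrite cls_section_shape cls_rep.
Qed.

Lemma pvec_smooth F : smooth F -> smooth (F \o pvec m (R := R)).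
Proof.
apply: smooth_comp_linear; first exact: pvec_linear.
by apply: rV_linear_continuous; exact: pvec_linear.
Qed.

(** Extensions are pulled back along [pvec] in one direction and along [svec] in the other. The
    latter is [section_shape] in coordinates, which takes values in the level set and is a right
    inverse of the move on classes. *)
Lemma pachner_r_diffeo : diffeo (@coord R X) (@coord R Y) (level_set e (2 * pi)) setT pachner_r.
Proof.
split=> [|f]; first exact: pachner_r_bij.
split=> -[F [sF hF]].
  exists (F \o pvec m (R := R)); split=> [|al /level_setE hw]; first exact: pvec_smooth.
  by rewrite /= pachner_r_cls // hF // coord_pachner_shape.
exists (F \o svec m (R := R)); split=> [|be _].
  apply: smooth_comp_linear => //; first exact: svec_linear.
  by apply: rV_linear_continuous; exact: svec_linear.
rewrite /= -coord_section_shape -hF /=; first by rewrite cls_section_shape.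
exact/level_setE/section_shape_weight.
Qed.

Lemma lift_ofP (Z : pseudo3) (S : set (Sr R Z)) f : smooth_on (@coord R Z) S f ->
  is_lift (@coord R Z) S f (lift_of S f).
Proof. exact: xgetPex. Qed.

Lemma shift_shape (Z : pseudo3) (al : gshape R Z) u (h : R) :
  vtangent u -> exists be : gshape R Z, coord be = h *: vec u + coord al.
Proof.
move=> hu; have [|be E] := @gshape_ex Z (fun a => h * u a + al a).
  by move=> t v; rewrite vsum_lin hu gshape_vsum mulr0 add0r.
by exists be; rewrite coordE E vec_lin.
Qed.

(** [lift_of] picks arbitrary extensions, whose values are known only on shapes, and on X only on
    those of weight [2 * pi] at e. So [NZ_congr] is applied twice: along [T] to replace the lifts on
    X by pull-backs of those on Y, and along [vtangent] to change the representative on Y. *)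
Lemma poisson_eq f g c : smooth_on (@coord R Y) setT f -> smooth_on (@coord R Y) setT g ->
  level_set e (2 * pi) c ->
  poisson (level_set e (2 * pi)) (f \o pachner_r) (g \o pachner_r) c = poisson setT f g (pachner_r c).
Proof.
move=> sf sg /level_set_rep hw; rewrite /poisson.
have [_ hd] := pachner_r_diffeo.
have [sF1 hF1] := lift_ofP (proj1 (hd f) sf); have [sG1 hG1] := lift_ofP (proj1 (hd g) sg).
have [sF2 hF2] := lift_ofP sf; have [sG2 hG2] := lift_ofP sg.
move: (lift_of _ (f \o pachner_r)) (lift_of _ (g \o pachner_r)) sF1 hF1 sG1 hG1 => F1 G1 sF1 hF1 sG1 hG1.
move: (lift_of _ f) (lift_of _ g) sF2 hF2 sG2 hG2 => F2 G2 sF2 hF2 sG2 hG2.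
set al := rep c in hw *.
pose T u := vtangent u /\ \sum_a chi m R a * u a = 0.
have TJ : T (J (chi m R)).
  by split; [exact: J_vtangent | apply: J_isgauge; exact: chi_gauge].
have agree (F : 'rV[R]_#|tetedge X| -> R) (F' : 'rV[R]_#|tetedge Y| -> R) (fn : Sr R Y -> R) : (forall a, level_set e (2 * pi) (cls _ a) -> (fn \o pachner_r) (cls _ a) = F (coord a)) ->
    (forall b, [set: Sr R Y] (cls _ b) -> fn (cls _ b) = F' (coord b)) ->
    forall u, T u -> 'D_(vec u) F (coord al) = 'D_(vec u) (F' \o pvec m (R := R)) (coord al).
  move=> h1 h2 u [tu wu]; apply: (@derive_congr R _ F (F' \o pvec m (R := R))) => h.
  have [be E] := shift_shape al h tu; rewrite -E.
  have hbe : weight be e = 2 * pi.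
    have Eb a : be a = h * u a + al a.
      have := congr1 (fun x => unvec x a) E; rewrite vecK unvec_lin => ->.
      by rewrite !vecK.
    rewrite weightE; have -> : \sum_a chi m R a * be a = h * (\sum_a chi m R a * u a) + \sum_a chi m R a * al a.
      by rewrite big_distrr -big_split; apply: eq_bigr => a _; rewrite Eb /=; ring.
    by rewrite wu mulr0 add0r -weightE.
  by rewrite -h1; [rewrite /= pachner_r_cls // h2 // coord_pachner_shape | exact/level_setE].
(* A pull-back along P has zero derivative in the direction [J chi], which P kills. *)
have d0 (F : 'rV[R]_#|tetedge Y| -> R) x : differentiable F (pvec m x) -> 'D_(vec (J (chi m R))) (F \o pvec m (R := R)) x = 0.
  move=> dF; rewrite (@derive_comp_linear R _ _ (pvec m (R := R)) F) //; last first.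
  - by apply: rV_linear_continuous; exact: pvec_linear.
  - exact: pvec_linear.
  rewrite pvec_vec derive_vec //; apply: big1 => b _.
  by rewrite -(pachner_rel_uniq b (compat_J (chi_compat m R) (@chi_inner _ _ _ m R))) J0 mul0r.
have dif (V : normedModType R) (F : V -> R) x : smooth F -> differentiable F x.
  by move=> sF; exact: (sF [::] x).
(* By skewness, the derivative of the weight of e along the Hamiltonian field of [F] is minus that
   of [F] along [J chi]. *)
have Tgrad (F : 'rV[R]_#|tetedge X| -> R) : differentiable F (coord al) -> 'D_(vec (J (chi m R))) F (coord al) = 0 ->
    T (J (fun b => pderiv b F (coord al))).
  move=> dF h0; split; first exact: J_vtangent.
  rewrite J_skew; apply/eqP; rewrite oppr_eq0; apply/eqP.
  by rewrite -[RHS]h0 derive_vec //; apply: eq_bigr => a _; rewrite mulrC.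
rewrite (NZ_congr (F' := F2 \o pvec m (R := R)) (G' := G2 \o pvec m (R := R)) (x' := coord al) (T := T)); first last.
- by apply: Tgrad; [exact/dif/pvec_smooth | exact/d0/dif].
- by apply: Tgrad; [exact: dif | rewrite (agree _ _ _ hG1 hG2) //; exact/d0/dif].
- exact: agree hG1 hG2.
- exact: agree hF1 hF2.
- exact/dif/pvec_smooth.
- exact/dif/pvec_smooth.
- exact: dif.
- exact: dif.
rewrite NZ_pvec; [|exact: dif..]; rewrite -coord_pachner_shape //.
(* Moving two gauge equivalent shapes along the same tangent vector keeps them equivalent by the
   same gauge function, so the function on classes takes equal values along the two lines. *)
have agree2 (F : 'rV[R]_#|tetedge Y| -> R) (fn : Sr R Y -> R) : (forall b, [set: Sr R Y] (cls _ b) -> fn (cls _ b) = F (coord b)) ->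
    forall u, vtangent u -> 'D_(vec u) F (coord (pachner_shape al)) = 'D_(vec u) F (coord (rep (pachner_r c))).
  move=> h2 u tu; apply: derive_congr => h.
  have [b1 E1] := shift_shape (pachner_shape al) h tu; have [b2 E2] := shift_shape (rep (pachner_r c)) h tu.
  rewrite -E1 -E2 -(h2 b1 I) -(h2 b2 I); congr fn; apply/cls_gauge.
  have /cls_gauge/gauge_equivP[G hG hg] : cls (@gauge_equiv R Y) (pachner_shape al) = cls _ (rep (pachner_r c)).
    by rewrite cls_rep.
  apply/gauge_equivP; exists G => // a.
  have := congr1 (fun x => unvec x a) E1; have := congr1 (fun x => unvec x a) E2.
  by rewrite !vecK !unvec_lin !vecK hg => -> ->; rewrite addrA.
apply: (NZ_congr (T := @vtangent R Y)); try exact: dif.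
- exact: agree2 hF2.
- exact: agree2 hG2.
- exact: J_vtangent.
- exact: J_vtangent.
Qed.

Lemma pachner_r_poisson : poisson_iso (level_set e (2 * pi)) setT pachner_r.
Proof. by split=> [|f g sf sg c hc]; [exact: pachner_r_diffeo | exact: poisson_eq]. Qed.

(** * Levels and the bundle map *)

Definition level_shift (A : tetedge X -> R) : R := (\sum_a chi m R a * J A a) / (12 * pi).

Lemma level_shift_lin c A B : level_shift (fun a => c * A a + B a) = c * level_shift A + level_shift B.
Proof.
rewrite /level_shift mulrA -mulrDl; congr (_ / _); rewrite big_distrr -big_split.
by apply: eq_bigr => a _; rewrite J_lin /=; ring.
Qed.

(** [level_shift] is the correction term of [pachner_level]. It is linear in the angles, and
    skewness of [J] turns its variation into the pairing that appears in [lev_pachner_map]. *)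
Lemma level_shift_gauge (al be : tetedge X -> R) G : (forall a, be a = al a + pi * J G a) ->
  level_shift be = level_shift al - (\sum_a J (chi m R) a * J G a) / 12.
Proof.
move=> h; have -> : be = (fun a => pi * J G a + al a).
  by apply/funext => a; rewrite h addrC.
rewrite level_shift_lin addrC {2}/level_shift J_skew.
have -> : \sum_a J G a * J (chi m R) a = \sum_a J (chi m R) a * J G a.
  by apply: eq_bigr => a _; rewrite mulrC.
have /lt0r_neq0 hpi := pi_gt0 R; move: (\sum_a _) (level_shift al) => s l.
by move: pi hpi => p hp; field.
Qed.

(* The level is shifted by the opposite of the correction in [pachner_level]:
   with the signs of [gauge_angle] and [gauge_level], the gauge transformation
   at e changes both the level and [level_shift] by -1, so only their difference
   descends to the quotient. *)
Definition pachner_lshape (x : lgshape R X) : lgshape R Y := (pachner_shape x.1, x.2 - level_shift x.1).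

Definition pachner_lr (c : LSr R X) : LSr R Y := cls _ (pachner_lshape (rep c)).

Lemma lev_fwd (al : gshape R X) G G' c : weight al e = 2 * pi ->
  compat m G G' -> inner_const m G c ->
  lev G al + (\sum_a J (chi m R) a * J G a) / 12 = lev G' (pachner_shape al).
Proof.
move=> hw hc hi; have -> : angle (pachner_shape al) = pachner_map m al by apply/funext => b; exact: pachner_shapeE.
by apply: lev_pachner_map hc hi; [exact: gshape_vsum | rewrite -two_pi -weightE].
Qed.

Lemma pachner_lshape_gauge (x y : lgshape R X) : weight x.1 e = 2 * pi ->
  lgauge_equiv x y -> lgauge_equiv (pachner_lshape x) (pachner_lshape y).
Proof.
move=> hw /lgauge_equivP[G [hG h1 h2]].
have hw' : weight y.1 e = 2 * pi.
  by rewrite -hw; apply/esym/weight_gauge/gauge_equivP; exists G.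
have [G' hc hG'] := compat_ex_new m hG; have [c hi] := isgauge_inner hG.
apply/lgauge_equivP; exists G'; split=> // [b|] /=.
  by rewrite !pachner_shapeE // (gauge_fwd hc hi h1).
by rewrite -(lev_fwd hw hc hi) (level_shift_gauge h1) h2; ring.
Qed.

Lemma pachner_lr_cls (x : lgshape R X) : weight x.1 e = 2 * pi -> pachner_lr (cls _ x) = cls _ (pachner_lshape x).
Proof.
move=> hw; apply/esym/cls_lgauge/pachner_lshape_gauge => //.
by apply/cls_lgauge; rewrite cls_rep.
Qed.

Lemma LSproj_weight (c : LSr R X) : level_set e (2 * pi) (LSproj c) ->
  weight (rep c).1 e = 2 * pi.
Proof. by move/level_setE. Qed.

Definition section_lshape (y : lgshape R Y) : lgshape R X := (section_shape y.1, y.2 + level_shift (section_shape y.1)).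

Lemma cls_section_lshape y : pachner_lr (cls _ (section_lshape y)) = cls _ y.
Proof.
rewrite pachner_lr_cls; last exact: section_shape_weight.
apply/cls_lgauge/lgauge_equivP; exists (fun=> 0); split=> [|b|]; first exact: isgauge0.
  by rewrite pachner_shape_section J0 mulr0 addr0.
by rewrite /lev big1 => [|a _]; rewrite ?mul0r //=; ring.
Qed.

Lemma LSproj_section_lshape y : level_set e (2 * pi) (LSproj (cls _ (section_lshape y))).
Proof. by rewrite LSproj_cls; exact/level_setE/section_shape_weight. Qed.

Lemma pachner_lr_bij : set_bij (fun c => level_set e (2 * pi) (LSproj c))
  (fun c => [set: Sr R Y] (LSproj c)) pachner_lr.
Proof.
split=> [c _ //|c d|c _].
  rewrite !inE => /LSproj_weight hc /LSproj_weight hd /cls_lgauge/lgauge_equivP[G' [hG' h1 h2]].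
  have h' b : pachner_map m (rep d).1 b = pachner_map m (rep c).1 b + pi * J G' b.
    by rewrite -!pachner_shapeE //; exact: h1.
  have [G [k [hG hco hi E]]] := gauge_bwd hG' h'.
  rewrite -(cls_rep c) -(cls_rep d); apply/cls_lgauge/lgauge_equivP; exists G; split=> //.
  (* The variation of [level_shift] cancels the pairing in [lev_fwd], which turns the relation of
     levels on Y into the one on X. *)
  move: h2; rewrite /= -(lev_fwd hc hco hi) (level_shift_gauge E) => h2.
  lra.
exists (cls _ (section_lshape (rep c))); first exact: LSproj_section_lshape.
by rewrite cls_section_lshape cls_rep.
Qed.

Definition plvec (x : 'rV[R]_#|tetedge X| * R) : 'rV[R]_#|tetedge Y| * R :=
  (pvec m x.1, x.2 - level_shift (unvec x.1)).
Definition slvec (y : 'rV[R]_#|tetedge Y| * R) : 'rV[R]_#|tetedge X| * R :=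
  (svec m y.1, y.2 + level_shift (unvec (svec m y.1))).

Lemma plvec_linear : linear plvec.
Proof.
move=> c x y; apply: injective_projections => /=; first exact: pvec_linear.
by rewrite unvec_lin level_shift_lin -[c *: x.2]/(c * x.2) -[c *: (_ - _)]/(c * (_ - _)); ring.
Qed.

Lemma slvec_linear : linear slvec.
Proof.
move=> c x y; apply: injective_projections => /=; first exact: svec_linear.
rewrite svec_linear unvec_lin level_shift_lin -[c *: x.2]/(c * x.2) -[c *: (_ + _)]/(c * (_ + _)).
ring.
Qed.

Lemma pachner_lr_diffeo : diffeo (@lcoord R X) (@lcoord R Y)
  (fun c => level_set e (2 * pi) (LSproj c)) (fun c => [set: Sr R Y] (LSproj c)) pachner_lr.
Proof.
split=> [|f]; first exact: pachner_lr_bij.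
split=> -[F [sF hF]].
  exists (F \o plvec); split=> [|x].
    apply: smooth_comp_linear => //; first exact: plvec_linear.
    by apply: prod_linear_continuous; exact: plvec_linear.
  rewrite LSproj_cls => /level_setE hw; rewrite /= pachner_lr_cls // hF //; congr F.
  by rewrite /lcoord /plvec /= coord_pachner_shape // coordE vec_unvec.
exists (F \o slvec); split=> [|y _].
  apply: smooth_comp_linear => //; first exact: slvec_linear.
  by apply: prod_linear_continuous; exact: slvec_linear.
rewrite -(cls_section_lshape y) -[f _]/((f \o pachner_lr) (cls _ (section_lshape y))) hF; last exact: LSproj_section_lshape.
congr F; rewrite /lcoord /slvec /= -coord_section_shape; congr (_, _ + level_shift _).
by rewrite coordE vec_unvec.
Qed.

Lemma pachner_lr_bundle : affine_bundle_iso (level_set e (2 * pi)) setT pachner_r pachner_lr.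
Proof.
split; first exact: pachner_lr_diffeo.
  move=> c hc; rewrite -(cls_rep c) in hc *; move: (rep c) hc => x.
  by rewrite !(LSproj_cls x) => /level_setE hw; rewrite pachner_lr_cls // LSproj_cls pachner_r_cls.
move=> s c hc; rewrite -(cls_rep c) in hc *; move: (rep c) hc => x.
rewrite LSproj_cls => /level_setE hw.
rewrite (LStrans_cls s x) !pachner_lr_cls // LStrans_cls; congr cls.
by rewrite /pachner_lshape /=; congr (_, _); ring.
Qed.
End Gauge_classes.

Theorem theorem2 (R : realType) (X Y : pseudo3) (e : edge X)
    (m : pachner32 Y e)
    (alX : gshape R X) (alY : gshape R Y) (lX lY : R)
    (hX : is_shape alX) (hY : is_shape alY)
    (he : balanced alX e)
    (hm : pachner_angles m alX alY)
    (hl : pachner_level e alX lX lY) :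
  exists Pr : Sr R X -> Sr R Y,
    [/\ pachner_induced m Pr,
        poisson_iso (level_set e (2 * pi)) setT Pr
      & exists L : LSr R X -> LSr R Y,
          affine_bundle_iso (level_set e (2 * pi)) setT Pr L].
Proof.
exists (pachner_r m alY); split; [exact: pachner_r_induced | exact: pachner_r_poisson |].
by exists (pachner_lr m alY); exact: pachner_lr_bundle.
Qed.
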